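(* Let $m,n$ be positive integers satisfying $$\tfrac mn\le\tfrac12,\qquad (m,n)\ne(1,3).$$ Let $\|\cdot\|_1$ be any norm on $\mathbb{R}^n$ and $\|\cdot\|_2$ any norm on $\mathbb{R}^m$. Then there exists $c_{m,n}=c_{m,n}(\|\cdot\|_1,\|\cdot\|_2)>0$ such that for any $c\in[0,c_{m,n}]$ we have $$\dim_H FS_{m,n}(\|\cdot\|_1,\|\cdot\|_2,c)\ \ge\ (n-2)m .$$ The analogous claim holds when restricting to those $\Omega\in FS_{m,n}(\|\cdot\|_1,\|\cdot\|_2,c)$ such that (i) $\Omega$ has full $\mathbb{R}$-rank $m$, and (ii) the set of all entries $\Omega_{i,j}$ of $\Omega$ together with $1$ is linearly independent over $\mathbb{Q}$.
   Context: For norms $\|\cdot\|_1$ on $\mathbb{R}^n$ and $\|\cdot\|_2$ on $\mathbb{R}^m$, $\Omega\in\mathbb{R}^{m\times n}$ and $t\ge1$ let $$\psi_\Omega(t)=\min\{\|\Omega\hat{\boldsymbol b}+\tilde{\boldsymbol b}\|_2:\hat{\boldsymbol b}\in\mathbb{Z}^n,\ \tilde{\boldsymbol b}\in\mathbb{Z}^m,\ 1\le\|\hat{\boldsymbol b}\|_1\le t\},$$ $\Theta(\Omega)=\limsup_{t\to\infty}t^{n/m}\psi_\Omega(t)$ and $\widetilde\Theta(\Omega)=\liminf_{t\to\infty}t^{n/m}\psi_\Omega(t)$. Put $DI_{m,n}(\|\cdot\|_1,\|\cdot\|_2,c)=\{\Omega\in\mathbb{R}^{m\times n}:\Theta(\Omega)=c\}$,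 $Bad_{m,n}=\{\Omega:\widetilde\Theta(\Omega)>0\}$ (independent of the norms), and for $c\ge0$ $$FS_{m,n}(\|\cdot\|_1,\|\cdot\|_2,c)=DI_{m,n}(\|\cdot\|_1,\|\cdot\|_2,c)\setminus Bad_{m,n}.$$ In (ii), the $mn$ entries and the number $1$ are meant as a family of $mn+1$ real numbers. $\dim_H$ denotes Hausdorff dimension. *)

(* Defs.v *)
From HB Require Import structures.
From mathcomp Require Import all_boot all_order all_algebra.
From mathcomp Require Import zify.
From mathcomp Require Import all_classical all_reals all_analysis.
Set Implicit Arguments.
Unset Strict Implicit.
Unset Printing Implicit Defensive.
Import Order.TTheory GRing.Theory Num.Theory.
Import numFieldNormedType.Exports.
Local Open Scope classical_set_scope.
Local Open Scope ring_scope.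

Definition is_norm (R : realType) (d : nat) (N : 'cV[R]_d -> R) : Prop :=
  [/\ forall x, N x = 0 -> x = 0,
      forall (a : R) x, N (a *: x) = `|a| * N x
    & forall x y, N (x + y) <= N x + N y].

Section hausdorff.
Variables (R : realType) (V : normedModType R).
Implicit Types (A : set V) (s delta : R).
Local Open Scope ereal_scope.

(* The diameter of the empty set is -oo here. *)
Definition diameter A : \bar R :=
  ereal_sup [set `|x - y|%:E | x in A & y in A].

(* Covers are infinite sequences of sets; a finite cover is padded with empty
   sets, which must contribute 0 even when s = 0 (where x `^ 0 = 1). *)
Definition gauge s A : \bar R :=
  if A == set0 then 0 else diameter A `^ s.

Definition hausdorff_content s delta A : \bar R :=
  ereal_inf [set \sum_(0 <= i <oo) gauge s (U i) |
    U in [set U : (set V)^nat |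
      A `<=` \bigcup_i U i /\ forall i, diameter (U i) <= delta%:E]].

Definition hausdorff_measure s A : \bar R :=
  ereal_sup [set hausdorff_content s delta A | delta in [set r : R | (0 < r)%R]].

(* The usual convention: the empty set has dimension 0. *)
Definition hausdorff_dim A : \bar R :=
  ereal_inf [set s%:E | s in
    [set s : R | (0 <= s)%R /\ hausdorff_measure s A = 0]].

End hausdorff.

Section dirichlet.
Variables (R : realType) (m n : nat).
Variables (N1 : 'cV[R]_n -> R) (N2 : 'cV[R]_m -> R).

(* The infimum is over a set of reals; psi_attained below shows that it is a
   minimum. It is +oo when no integer vector satisfies 1 <= N1 b <= t. *)
Definition psi (Om : 'M[R]_(m, n)) (t : R) : \bar R :=
  ereal_inf [set (N2 (Om *m map_mx intr b + map_mx intr b'))%:E |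
    b in [set b : 'cV[int]_n | 1 <= N1 (map_mx intr b) <= t] &
    b' in [set: 'cV[int]_m]].

Definition scaled_psi (Om : 'M[R]_(m, n)) (t : R) : \bar R :=
  ((t `^ (n%:R / m%:R))%:E * psi Om t)%E.

Definition Theta (Om : 'M[R]_(m, n)) : \bar R :=
  limf_esup (scaled_psi Om) (pinfty_nbhs R).

Definition Theta_inf (Om : 'M[R]_(m, n)) : \bar R :=
  limf_einf (scaled_psi Om) (pinfty_nbhs R).

Definition DI (c : R) : set 'M[R]_(m, n) := [set Om | Theta Om = c%:E].

(* As a set, Bad depends on neither N1 nor N2. *)
Definition Bad : set 'M[R]_(m, n) := [set Om | (0 < Theta_inf Om)%E].

Definition FS (c : R) : set 'M[R]_(m, n) := DI c `\` Bad.

End dirichlet.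

Definition lin_indep_rat (R : realType) (I : finType) (v : I -> R) : Prop :=
  forall a : I -> rat, \sum_i ratr (a i) * v i = 0 -> forall i, a i = 0.

(* The entries of Om and the number 1, indexed by None. *)
Definition entries1 (R : realType) (m n : nat) (Om : 'M[R]_(m, n))
    (k : option ('I_m * 'I_n)) : R :=
  if k is Some (i, j) then Om i j else 1.

Section psi_attained.
Variable R : realType.

Lemma is_norm0 d (N : 'cV[R]_d -> R) : is_norm N -> N 0 = 0.
Proof. by case=> _ NZ _; rewrite -(scale0r 0) NZ normr0 mul0r. Qed.

Lemma is_normN d (N : 'cV[R]_d -> R) x : is_norm N -> N (- x) = N x.
Proof. by case=> _ NZ _; rewrite -scaleN1r NZ normrN1 mul1r. Qed.

Lemma is_norm_ge0 d (N : 'cV[R]_d -> R) x : is_norm N -> 0 <= N x.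
Proof.
move=> nN; have [_ _ ND] := nN; have := ND x (- x).
by rewrite subrr is_norm0// is_normN// -mulr2n pmulrn_lge0.
Qed.

Lemma is_norm_le d (N : 'cV[R]_d -> R) : is_norm N ->
  exists2 C, 0 < C & forall x : 'cV[R]_d, N x <= C * `|x|.
Proof.
move=> nN; have [_ NZ ND] := nN.
exists (1 + \sum_(i < d) N (delta_mx i 0)).
  by rewrite ltr_pwDl// sumr_ge0// => i _; exact: is_norm_ge0.
move=> x; apply: (@le_trans _ _ (\sum_(i < d) `|x| * N (delta_mx i 0))).
  have {1}-> : x = \sum_(i < d) x i 0 *: delta_mx i 0.
    rewrite {1}(matrix_sum_delta x); apply: eq_bigr => i _.
    by rewrite big_ord1.
  apply: (@le_trans _ _ (\sum_(i < d) N (x i 0 *: delta_mx i 0))).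
    elim/big_ind2 : _ => [|u a v b ua vb|//]; first by rewrite is_norm0.
    by rewrite (le_trans (ND _ _))// lerD.
  apply: ler_sum => i _; rewrite NZ ler_wpM2r//; first exact: is_norm_ge0.
  by rewrite [leRHS]/Num.norm/= mx_normrE; apply/bigmax_geP; right; exists (i, 0).
by rewrite -mulr_sumr mulrC ler_wpM2r// lerDr.
Qed.

Lemma is_norm_ge d (N : 'cV[R]_d -> R) : is_norm N ->
  exists2 k, 0 < k & forall x : 'cV[R]_d, k * `|x| <= N x.
Proof.
move=> nN; have [N0 NZ ND] := nN; have [C C0 NC] := is_norm_le nN.
pose S := [set x : 'rV[R]_d | `|x| = 1].
have trN (x : 'rV[R]_d) : `|x^T| = `|x|.
  rewrite /Num.norm/= !mx_normrE; apply/le_anti/andP; split; apply/bigmax_leP;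
    split => [|[i j] _ /=]; rewrite ?bigmax_ge_id//.
    by rewrite mxE; apply/bigmax_geP; right; exists (j, i).
  by apply/bigmax_geP; right; exists (j, i); rewrite // mxE.
have trN' (x : 'cV[R]_d) : `|x^T| = `|x| by rewrite -trN trmxK.
have Nlip (x y : 'cV[R]_d) : `|N x - N y| <= C * `|x - y|.
  have H u v : N u - N v <= C * `|u - v|.
    rewrite lerBlDr (le_trans _ (lerD (NC _) (lexx _)))//.
    by rewrite (le_trans _ (ND _ _))// subrK.
  by rewrite ler_norml H andbT lerNl opprB distrC.
have Ncont : continuous (fun x : 'rV[R]_d => N x^T).
  move=> x; apply/(@cvgrPdist_lt _ R^o _ _ (nbhs_filter x)) => e e0; apply/nbhs_ballP.
  exists (e / C); rewrite /= ?divr_gt0// => y; rewrite -ball_normE/= => xy.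
  by rewrite (le_lt_trans (Nlip _ _))// -linearB/= trN mulrC -ltr_pdivlMr.
have [S0|/set0P S0] := eqVneq S set0.
  exists 1 => // x; suff -> : x = 0 by rewrite normr0 mulr0 is_norm0.
  apply/eqP/negP => /negP x0.
  suff : S (`|x|^-1 *: x)^T by rewrite S0.
  by rewrite /S/= trN' normrZ normfV normr_id mulVf ?normr_eq0.
have cS : compact S.
  apply: bounded_closed_compact.
    by exists 1; split => // M M1 x /= ->; exact: ltW.
  have -> : S = Num.norm @^-1` [set (1:R)] by [].
  apply: preimage_closed; last exact: closed_eq.
  by move=> x _; exact: norm_continuous.
have [u /[!inE] Su uS] := EVT_min_rV S0 cS (continuous_subspaceT Ncont).
have Nu0 : 0 < N u^T.
  rewrite lt_neqAle is_norm_ge0// andbT eq_sym; apply/eqP => /N0 u0.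
  move: Su; rewrite /S/= -trN u0 normr0 => /esym/eqP.
  by rewrite oner_eq0.
exists (N u^T) => // x; have [->|x0] := eqVneq x 0.
  by rewrite normr0 mulr0 is_norm0.
have nx0 : 0 < `|x| by rewrite normr_gt0.
have := uS (`|x|^-1 *: x)^T; rewrite inE trmxK NZ normfV normr_id => H.
rewrite -ler_pdivlMr// mulrC; apply: H.
by rewrite /S/= trN' normrZ normfV normr_id mulVf ?normr_eq0.
Qed.

Lemma cV_entry_le d (x : 'cV[R]_d) M : `|x| <= M -> forall i, `|x i 0| <= M.
Proof.
move=> xM i; apply: le_trans xM.
by rewrite [leRHS]/Num.norm/= mx_normrE; apply/bigmax_geP; right; exists (i, 0).
Qed.

Definition box_dec K d (f : 'cV['I_(K + K).+1]_d) : 'cV[int]_d :=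
  map_mx (fun k : 'I_(K + K).+1 => (k : nat)%:Z - K%:Z) f.

Lemma box_decP K d (b : 'cV[int]_d) :
  `|map_mx intr b : 'cV[R]_d| <= K%:R -> exists f, b = @box_dec K d f.
Proof.
move=> bK; exists (map_mx (fun z : int => inord `|(z + K%:Z)%R|%N) b).
apply/matrixP => i j; rewrite !mxE ord1.
have := cV_entry_le bK i; rewrite mxE -intr_norm -[K%:R]/(K%:Z%:~R) ler_int.
move=> biK; rewrite inordK; lia.
Qed.

Lemma psi_attained m n (N1 : 'cV[R]_n -> R) (N2 : 'cV[R]_m -> R)
    (Om : 'M[R]_(m, n)) (t : R) (b0 : 'cV[int]_n) :
  is_norm N1 -> is_norm N2 -> 1 <= N1 (map_mx intr b0) <= t ->
  exists b b', 1 <= N1 (map_mx intr b) <= t /\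
    psi N1 N2 Om t = (N2 (Om *m map_mx intr b + map_mx intr b'))%:E.
Proof.
move=> nN1 nN2 b0t.
have [k1 k10 k1N] := is_norm_ge nN1; have [k2 k20 k2N] := is_norm_ge nN2.
pose F (p : 'cV[int]_n * 'cV[int]_m) : R :=
  N2 (Om *m map_mx intr p.1 + map_mx intr p.2).
pose v0 := F (b0, 0).
have [C C0 NC] : exists2 C, 0 < C & forall x : 'cV[R]_n, `|Om *m x| <= C * `|x|.
  exists (1 + \sum_i \sum_j `|Om i j|).
    by rewrite ltr_pwDl// sumr_ge0// => i _; rewrite sumr_ge0.
  move=> x; rewrite [leLHS]/Num.norm/= mx_normrE; apply/bigmax_leP; split.
    by rewrite mulr_ge0// addr_ge0// sumr_ge0// => i _; rewrite sumr_ge0.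
  move=> [i j] _ /=; rewrite mxE (le_trans (ler_norm_sum _ _ _))//.
  apply: (@le_trans _ _ (\sum_j `|Om i j| * `|x|)).
    apply: ler_sum => l _; rewrite normrM ler_wpM2l// ord1.
    exact: cV_entry_le.
  rewrite -mulr_suml ler_wpM2r// (bigD1 i)//= addrCA lerDl addr_ge0//.
  by rewrite sumr_ge0// => l _; rewrite sumr_ge0.
pose M := v0 / k2 + C * (t / k1) + t / k1.
have t0 : 0 <= t by case/andP: b0t => h1 h2; rewrite (le_trans _ (le_trans h1 h2)).
have v00 : 0 <= v0 by exact: is_norm_ge0.
have [K MK] : exists K : nat, M <= K%:R.
  exists (Num.bound `|M|).
  by rewrite (le_trans (ler_norm _))// ltW// archi_boundP.
have v0k2 : 0 <= v0 / k2 by rewrite divr_ge0// ltW.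
have tk1 : 0 <= t / k1 by rewrite divr_ge0// ltW.
have bnd b b' : N1 (map_mx intr b) <= t -> F (b, b') <= v0 ->
    exists f g, b = @box_dec K n f /\ b' = @box_dec K m g.
  move=> bt Fv.
  have nb : `|map_mx intr b : 'cV[R]_n| <= t / k1.
    by rewrite ler_pdivlMr// mulrC (le_trans (k1N _)).
  have nb' : `|map_mx intr b' : 'cV[R]_m| <= v0 / k2 + C * (t / k1).
    rewrite -(addKr (Om *m map_mx intr b) (map_mx intr b')) addrC.
    rewrite (le_trans (ler_normB _ _))// lerD//.
      by rewrite ler_pdivlMr// mulrC (le_trans (k2N _)).
    by rewrite (le_trans (NC _))// ler_wpM2l// ltW.
  have [|f ->] := @box_decP K n b.
    by rewrite (le_trans nb)// (le_trans _ MK)// lerDr addr_ge0// mulr_ge0// ltW.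
  have [|g ->] := @box_decP K m b'.
    by rewrite (le_trans nb')// (le_trans _ MK)// lerDl.
  by exists f, g.
have [f0 [g0 [b0E z0E]]] : exists f g, b0 = @box_dec K n f /\ 0 = @box_dec K m g.
  by apply: bnd => //; case/andP: b0t.
pose G (p : 'cV['I_(K + K).+1]_n * 'cV['I_(K + K).+1]_m) : R :=
  F (box_dec p.1, box_dec p.2).
pose P (p : 'cV['I_(K + K).+1]_n * 'cV['I_(K + K).+1]_m) :=
  1 <= N1 (map_mx intr (box_dec p.1)) <= t.
have P0 : P (f0, g0) by rewrite /P/= -b0E.
case: (arg_minP G P0) => -[f g] Pfg minfg.
exists (box_dec f), (box_dec g); split => //; apply/le_anti/andP; split.
  by apply: ereal_inf_lbound; exists (box_dec f) => //; exists (box_dec g).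
apply: le_ereal_inf_tmp => _ [b /= bt [b' _ <-]]; rewrite lee_fin.
have [Fv|/ltW vF] := leP (F (b, b')) v0.
  have [f1 [g1 [bE b'E]]] := bnd _ _ (proj2 (andP bt)) Fv.
  have := minfg (f1, g1); rewrite /P/G/F/= -bE -b'E; exact.
apply: le_trans vF; have := minfg _ P0.
by rewrite /G/v0/= -b0E -z0E; exact.
Qed.

End psi_attained.

(* Main.v *)
(* Write Om = (A | B) with A an m x 2 matrix and B an m x (n - 2) matrix.  One
   fixed A is built for which Theta has the prescribed value c already when only
   the first two integer variables are used: A is the limit of rational matrices
   A_k, where A_k x_k is integral, x_(k+1) = N x_k + w with (x_k, w) a basis of
   the lattice of all v with A_k v integral, and A_(k+1) differs from A_k by a
   rank one matrix which vanishes at x_(k+1) and moves A_k x_k off the integers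
   by a vector of norm eps_k, with eps_k |x_(k+1)|^(n/m) close to c.  The
   inequality n/m >= 2 is what prevents other vectors shorter than x_(k+1) from
   doing better than eps_k.

   For every B this gives Theta <= c and Om not badly approximable.  For B random
   with independent uniform entries, a union bound over the integer vectors of
   norm at most |x_(k+1)| whose last n - 2 entries are not all zero shows that, for
   c small, with probability at least 1/2 none of them beats eps_k; so with
   positive probability this happens for infinitely many k, and then Theta = c.
   A set of B of positive Lebesgue measure has dimension m (n - 2), and the
   projection from Om to B is Lipschitz. *)
Require Import Defs.
From mathcomp Require Import all_boot all_order all_algebra.
From mathcomp Require Import zify ring lra.
From mathcomp Require Import measurable_realfun.
From mathcomp Require Import all_classical all_reals all_analysis.
Set Implicit Arguments.
Unset Strict Implicit.
Unset Printing Implicit Defensive.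
Import Order.TTheory GRing.Theory Num.Theory.
Import numFieldNormedType.Exports.
Local Open Scope classical_set_scope.
Local Open Scope ring_scope.

(** * Random matrices with independent uniform entries *)

Section product_bounds.
Local Open Scope ereal_scope.
Context d1 d2 (T1 : measurableType d1) (T2 : measurableType d2) (R : realType).
Variables (P1 : probability T1 R) (P2 : probability T2 R).

Lemma product_prob_le_xsection (A : set (T1 * T2)) (K : \bar R) :
  measurable A -> (forall x, P2 (xsection A x) <= K) -> (P1 \x P2) A <= K.
Proof.
move=> mA AK.
have K0 : 0 <= K by exact: le_trans (AK point).
apply: (@le_trans _ _ (\int[P1]_x K)).
  apply: ge0_le_integral => //; [exact: (measurable_fun_xsection P2 mA)|move=> z _; exact: AK].
rewrite integral_cst; [|exact: measurableT]; by rewrite [X in (_ * X)%E]probability_setT mule1.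
Qed.

Lemma product_prob_le_ysection (A : set (T1 * T2)) (K : \bar R) :
  measurable A -> (forall y, P1 (ysection A y) <= K) -> (P1 \x P2) A <= K.
Proof.
move=> mA AK.
have K0 : 0 <= K by exact: le_trans (AK point).
(* [P1 \x P2] integrates sections over the first factor. The product taken in the other order agrees
   with it on rectangles, so the two measures coincide. *)
have -> : (P1 \x P2) A = (P1 \x^ P2) A.
  apply: (product_measure_unique (m' := (P1 \x^ P2)%E : {measure set _ -> \bar R})) => //.
  by move=> A1 A2 mA1 mA2; exact: product_measure2E.
apply: (@le_trans _ _ (\int[P2]_y K)).
  apply: ge0_le_integral => //; [exact: (measurable_fun_ysection P1 mA)|move=> z _; exact: AK].
rewrite integral_cst; [|exact: measurableT]; by rewrite [X in (_ * X)%E]probability_setT mule1.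
Qed.

End product_bounds.

(* The last property: if one summand has small concentration on all translates of
   E, then so has the whole sum. *)
Lemma exists_iid (R : realType) d (X : measurableType d) (P : probability X R)
    (n : nat) :
  exists d' (W : measurableType d') (Q : probability W R) (t : 'I_n -> W -> X),
  [/\ forall i, measurable_fun setT (t i),
      forall (S : 'I_n -> set X) (K : 'I_n -> R), (forall i, measurable (S i)) ->
        (forall i, P (S i) <= (K i)%:E)%E ->
        (Q [set w | forall i, S i (t i w)] <= (\prod_i K i)%:E)%E
    & forall (f : 'I_n -> X -> R) (E : set R) (K : \bar R) i,
        (forall j, measurable_fun setT (f j)) -> measurable E ->
        (forall s : R, (P [set x | E (f i x + s)%R] <= K)%E) ->
        forall s : R, (Q [set w | E (\sum_j f j (t j w) + s)%R] <= K)%E].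
Proof.
elim: n => [|n [d' [W [Q [t [mt boxt sumt]]]]]].
  exists d, X, P, (fun=> id); split => [[]//|S K _ _|f E K []//].
  by rewrite big_ord0 probability_le1// (_ : mkset _ = setT)//; apply/seteqP; split => // w _ [].
(* Coordinate 0 reads the new factor [X]; the others read the space already built for [n]. *)
pose u (i : 'I_n.+1) (w : X * W) : X := if unlift ord0 i is Some j then t j w.2 else w.1.
have u0 w : u ord0 w = w.1 by rewrite /u unlift_none.
have uS j w : u (lift ord0 j) w = t j w.2 by rewrite /u liftK.
have mu i : measurable_fun setT (u i).
  rewrite /u; case: unliftP => [j _|_]; last exact: measurable_fst.
  exact: (measurableT_comp (mt j)).
exists _, (X * W)%type, ((P \x Q)%E : probability _ R), u; split => //.
  move=> S K mS PSK.
  have -> : [set w | forall i, S i (u i w)] =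
      S ord0 `*` [set w | forall i, S (lift ord0 i) (t i w)].
    apply/seteqP; split => -[x w] /=.
      move=> H; split; first by rewrite -[x]/(x, w).1 -u0; exact: H.
      by move=> i; have := H (lift ord0 i); rewrite uS.
    move=> [Sx H] i; rewrite /u; case: unliftP => [j ->|->//]; exact: H.
  have mH : measurable [set w | forall i, S (lift ord0 i) (t i w)].
    rewrite (_ : mkset _ = \big[setI/setT]_i (t i @^-1` S (lift ord0 i))).
      by apply: bigsetI_measurable => i _; rewrite -[X in measurable X]setTI; exact: mt.
    by rewrite -bigcap_seq; apply/seteqP; split => w /= H i => [_|]; apply: H; rewrite /= ?mem_index_enum.
  rewrite /= product_measure1E// big_ord_recl EFinM lee_pmul//.
    exact: PSK.
  apply: (boxt (fun i => S (lift ord0 i)) (fun i => K (lift ord0 i))) => i; [exact: mS|exact: PSK].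
move=> f E K i mf mE PE s.
pose F (w : X * W) : R := \sum_j f j (u j w) + s.
have mF : measurable_fun setT F.
  apply: measurable_funD => //; apply: measurable_sum => j.
  exact: (measurableT_comp (mf j)).
have mA : measurable [set w | E (F w)].
  by rewrite -[X in measurable X]setTI; exact: mF.
have FE w : F w = f ord0 w.1 + (\sum_j f (lift ord0 j) (t j w.2) + s).
  by rewrite /F big_ord_recl u0 addrA; under eq_bigr do rewrite uS.
rewrite /=; case: (unliftP ord0 i) => [j|] iE.
  apply: (@product_prob_le_xsection _ _ _ _ _ P Q _ _ mA) => x.
  have -> : xsection [set w | E (F w)] x =
      [set w | E (\sum_j f (lift ord0 j) (t j w) + (f ord0 x + s))].
    by apply/seteqP; split => w; rewrite /xsection/= inE/= FE/= addrCA.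
  apply: (sumt (fun j => f (lift ord0 j)) E K j) => // s'; rewrite -iE; exact: PE.
apply: (@product_prob_le_ysection _ _ _ _ _ P Q _ _ mA) => w.
have -> : ysection [set w | E (F w)] w =
    [set x | E (f ord0 x + (\sum_j f (lift ord0 j) (t j w) + s))].
  by apply/seteqP; split => x; rewrite /ysection/= inE/= FE.
by rewrite -iE.
Qed.

Definition near_int (R : realType) (e : R) : set R :=
  [set r | exists y : int, `|r + y%:~R| <= e].

Lemma measurable_near_int (R : realType) (e : R) : measurable (near_int e).
Proof.
rewrite (_ : near_int e = \bigcup_(y : int) `[- e - y%:~R, e - y%:~R]%classic).
  by apply: countable_bigcupT_measurable => // y; exact: measurable_itv.
apply/seteqP; split => r /=.
  by move=> [y]; rewrite ler_norml => /andP[h1 h2]; exists y => //=; rewrite in_itv/=; lra.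
by move=> [y _]; rewrite /= in_itv/= => h; exists y; rewrite ler_norml; lra.
Qed.

(** The identity under the uniform law is truncated to [0, 1], so that the bounds on [U] hold at
    every point and not only almost surely. *)
Lemma exists_unif (R : realType) :
  exists d (W : measurableType d) (P : probability W R) (U : W -> R),
  [/\ measurable_fun setT U, forall w, 0 <= U w <= 1
    & forall A : set R, measurable A -> (P (U @^-1` A) <= lebesgue_measure A)%E].
Proof.
pose U (x : R) := Num.max 0 (Num.min x 1).
have mU : measurable_fun [set: R] U.
  by apply: measurable_maxr => //; exact: measurable_minr.
exists _, (measurableTypeR R), (uniform_prob (@ltr01 R)), U; split => //.
  by move=> w; rewrite /U le_max lexx ge_max ler01 ge_min lexx orbT.
move=> A mA.
have mUA : measurable (U @^-1` A) by rewrite -[X in measurable X]setTI; exact: mU.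
have UA : U @^-1` A `&` `[0, 1] `<=` A.
  move=> x [/= + /[!in_itv]/= /andP[x0 x1]].
  by rewrite /U min_l// max_r.
have mUA' : measurable (U @^-1` A `&` `[0, 1]%classic) by exact: measurableI.
rewrite /= /uniform_prob integral_uniform_pdf.
rewrite (eq_integral (cst 1%E)); last first.
  by move=> x /[!inE]-[_ /=]; rewrite in_itv/= => x01; rewrite /uniform_pdf x01 subr0 invr1.
by rewrite integral_cst// mul1e le_measure// inE.
Qed.

Section unif.
Context (R : realType) d (W : measurableType d) (P : probability W R) (U : W -> R).
Hypotheses (mU : measurable_fun setT U) (U01 : forall w, 0 <= U w <= 1)
  (PU : forall A : set R, measurable A -> (P (U @^-1` A) <= lebesgue_measure A)%E).

(** For [e < 1/10], at most [2|q| + 3] integers can come within [e] of [q U + s], each for [U] in an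
    interval of length [2e/|q|]. The total is at most [10 e] as [|q| >= 1]; for larger [e] the bound
    is trivial. *)
Lemma prob_near_int (q : int) (e s : R) : q != 0 -> 0 <= e ->
  (P [set w | near_int e (q%:~R * U w + s)%R] <= (10 * e)%:E)%E.
Proof.
move=> q0 e0.
have mS : measurable [set w | near_int e (q%:~R * U w + s)].
  have : measurable_fun setT (fun w => q%:~R * U w + s).
    by apply: measurable_funD => //; exact: measurable_funM.
  by move=> /(_ measurableT _ (measurable_near_int e)); rewrite setTI.
have [e1|e1] := leP (1 / 10) e.
  by rewrite (le_trans (probability_le1 _ _))// lee_fin; lra.
pose K := (2 * `|q| + 3)%N; pose Q : R := `|q|%:R.
have Q1 : 1 <= Q by rewrite ler1n; lia.
have QE : Q = `|q%:~R| by rewrite -intr_norm /Q -abszE.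
(* An integer [y] with [|q U + s + y| <= e] is at least [- s - e - Q], hence at least [y0]; [c k] is
   the value of [U] at which [y = y0 + k] gives exactly 0. *)
pose y0 := Num.floor (- s - e - Q).
pose c k : R := - (s + (y0 + k%:Z)%:~R) / q%:~R.
pose I k := `[c k - e / Q, c k + e / Q]%classic.
have sub : [set w | near_int e (q%:~R * U w + s)] `<=` U @^-1` (\big[setU/set0]_(k < K) I k).
  move=> w [y wy]; rewrite /= -bigcup_mkord.
  have qU : - Q <= q%:~R * U w <= Q.
    have /andP[u0 u1] := U01 w.
    by rewrite -ler_norml normrM -QE ler_piMr// ?ger0_norm// (le_trans _ Q1).
  have /andP[f1 f2] := floor_itv (- s - e - Q).
  rewrite -/y0 in f1 f2.
  have [y1 y2] : y0%:~R - 1 < y%:~R :> R /\ y%:~R < y0%:~R + K%:R :> R.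
    move: wy; rewrite ler_norml; rewrite rmorphD/= in f2.
    have -> : K%:R = 2 * Q + 3 by rewrite /K natrD natrM.
    move=> wy; clear -wy qU f1 f2 e0 e1 Q1; move: (q%:~R * U w) (y%:~R : R) (y0%:~R : R) wy qU f1 f2 => v r r0; split; lra.
  have y0y : y0 <= y by rewrite -ltzD1 -(ltr_int R) rmorphD/=; lra.
  have yK : y < y0 + K%:Z by rewrite -(ltr_int R) rmorphD/=.
  have yE : y0 + `|y - y0|%N%:Z = y by rewrite gez0_abs ?subr_ge0// addrCA subrr addr0.
  exists `|y - y0|%N; first by rewrite /= -ltz_nat gez0_abs ?subr_ge0// ltrBlDl.
  rewrite /I/= in_itv/= -ler_distlC.
  have -> : c `|y - y0|%N = - (s + y%:~R) / q%:~R.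
    by rewrite /c yE.
  have q0' : q%:~R != 0 :> R by rewrite intr_eq0.
  rewrite ler_pdivlMr ?(lt_le_trans ltr01 Q1)// QE -normrM -normrN.
  by rewrite mulrBl mulfVK// opprB opprK mulrC addrA.
have mB : measurable (\big[setU/set0]_(k < K) I k).
  by apply: bigsetU_measurable => k _; exact: measurable_itv.
apply: (@le_trans _ _ (lebesgue_measure (\big[setU/set0]_(k < K) I k))).
  apply: (le_trans _ (PU mB)); apply: le_measure => //; rewrite inE//.
  by rewrite -[X in measurable X]setTI; exact: mU.
apply: (@le_trans _ _ (\sum_(k < K) lebesgue_measure (I k))%E).
  by apply: content_subadditive => // k _; exact: measurable_itv.
apply: (@le_trans _ _ (\sum_(k < K) (2 * e / Q)%:E)%E).
  apply: lee_sum => k _; rewrite /I lebesgue_measure_itv/= lte_fin.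
  have eQ : 0 <= e / Q by rewrite divr_ge0// (le_trans _ Q1).
  case: ifPn => [_|_]; last by rewrite lee_fin; lra.
  by rewrite -EFinB lee_fin; lra.
rewrite sumEFin lee_fin sumr_const card_ord -[leLHS]mulr_natr.
have -> : K%:R = 2 * Q + 3 by rewrite /K natrD natrM.
rewrite mulrAC ler_pdivrMr ?(lt_le_trans ltr01)//; nra.
Qed.

Lemma prob_affine_eq0 (a s : R) : a != 0 ->
  (P [set w | [set 0%R] (a * U w + s)%R] <= 0)%E.
Proof.
move=> a0; have -> : [set w | [set 0] (a * U w + s)] = U @^-1` [set - s / a].
  apply/seteqP; split => w /= H.
    by apply: (mulfI a0); rewrite mulrCA divff// mulr1; lra.
  by rewrite H mulrCA divff// mulr1 addNr.
by rewrite (le_trans (PU _))// lebesgue_measure_set1.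
Qed.

End unif.

(** Built in two stages: independent entries within a row, then independent rows. The three
    estimates serve the dimension bound, the union bound over integer vectors and the exclusion of
    rational relations. In the second, one nonzero [z j] controls each row, and independence of the
    rows gives the power [m]. *)
Lemma exists_unif_matrix (R : realType) (m p : nat) :
  exists d (W : measurableType d) (P : probability W R) (X : W -> 'M[R]_(m, p)),
  [/\ forall i j, measurable_fun setT (fun w => X w i j),
      forall w i j, 0 <= X w i j <= 1,
      forall (S : 'I_m -> 'I_p -> set R) (K : R), (forall i j, measurable (S i j)) ->
        (forall i j, lebesgue_measure (S i j) <= K%:E)%E ->
        (P [set w | forall i j, S i j (X w i j)] <= (K ^+ (m * p))%:E)%E,
      forall (z : 'I_p -> int) (s : 'I_m -> R) e, (exists j, z j != 0) -> 0 <= e ->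
        (P [set w | forall i, near_int e (\sum_j (z j)%:~R * X w i j + s i)%R] <=
         ((10 * e) ^+ m)%:E)%E
    & forall (a : 'I_m -> 'I_p -> R) s, (exists i j, a i j != 0) ->
        (P [set w | \sum_i \sum_j a i j * X w i j + s = 0]%R <= 0)%E].
Proof.
have [d0 [W0 [P0 [U [mU U01 PU]]]]] := exists_unif R.
have [d1 [W1 [P1 [t1 [mt1 box1 sum1]]]]] := exists_iid P0 p.
have [d2 [W2 [P2 [t2 [mt2 box2 sum2]]]]] := exists_iid P1 m.
have mU1 j : measurable_fun setT (fun w => U (t1 j w)) by exact: (measurableT_comp mU).
have mlin (a : 'I_p -> R) : measurable_fun setT (fun w => \sum_j a j * U (t1 j w)).
  by apply: measurable_sum => j; exact: measurable_funM.
have mrow (E : set R) (a : 'I_p -> R) s : measurable E ->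
    measurable [set w | E (\sum_j a j * U (t1 j w) + s)].
  move=> mE; have : measurable_fun setT (fun w => \sum_j a j * U (t1 j w) + s).
    by apply: measurable_funD.
  by move=> /(_ measurableT _ mE); rewrite setTI.
pose X w : 'M[R]_(m, p) := \matrix_(i, j) U (t1 j (t2 i w)).
have XE w i j : X w i j = U (t1 j (t2 i w)) by rewrite mxE.
have XS w i (a : 'I_p -> R) : \sum_j a j * X w i j = \sum_j a j * U (t1 j (t2 i w)).
  by apply: eq_bigr => j _; rewrite XE.
exists d2, W2, P2, X; split.
- move=> i j; under eq_fun do rewrite XE.
  exact: (measurableT_comp (mU1 j)).
- by move=> w i j; rewrite XE.
- move=> S K mS SK.
  have -> : [set w | forall i j, S i j (X w i j)] =
      [set w | forall i, [set w1 | forall j, (U @^-1` S i j) (t1 j w1)] (t2 i w)].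
    by apply/seteqP; split => w H i j; have := H i j; rewrite /= XE.
  have mUS i j : measurable (U @^-1` S i j) by rewrite -[X in measurable X]setTI; exact: mU.
  rewrite mulnC exprM -[m in leRHS]card_ord -prodr_const.
  apply: (box2 (fun i => [set w1 | forall j, (U @^-1` S i j) (t1 j w1)])) => i.
    rewrite (_ : mkset _ = \big[setI/setT]_j ((fun w => U (t1 j w)) @^-1` S i j)).
      by apply: bigsetI_measurable => j _; rewrite -[X in measurable X]setTI; exact: mU1.
    by rewrite -bigcap_seq; apply/seteqP; split => w /= H j => [_|]; apply: H; rewrite /= ?mem_index_enum.
  have -> : K ^+ p = \prod_(j < p) K by rewrite prodr_const card_ord.
  by apply: (box1 (fun j => U @^-1` S i j)) => // j; exact: le_trans (PU _ (mS i j)) (SK i j).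
- move=> z s e [j0 zj0] e0.
  have -> : [set w | forall i, near_int e (\sum_j (z j)%:~R * X w i j + s i)] =
      [set w | forall i, [set w1 | near_int e (\sum_j (z j)%:~R * U (t1 j w1) + s i)] (t2 i w)].
    by apply/seteqP; split => w H i; have := H i; rewrite /= XS.
  rewrite -[m in leRHS]card_ord -prodr_const.
  apply: (box2 (fun i => [set w1 | near_int e (\sum_j (z j)%:~R * U (t1 j w1) + s i)])) => i.
    by apply: mrow; exact: measurable_near_int.
  apply: (sum1 (fun j u => (z j)%:~R * U u) (near_int e) _ j0) => [j||s'].
  + exact: measurable_funM.
  + exact: measurable_near_int.
  + exact: (prob_near_int mU U01 PU).
- move=> a s [i0 [j0 aij]].
  have -> : [set w | \sum_i \sum_j a i j * X w i j + s = 0] =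
      [set w | [set 0] (\sum_i (fun w1 => \sum_j a i j * U (t1 j w1)) (t2 i w) + s)].
    by apply/seteqP; split => w; rewrite /= (eq_bigr _ (fun i _ => XS w i (a i))).
  apply: (sum2 (fun i w1 => \sum_j a i j * U (t1 j w1)) [set 0] 0%E i0) => //.
  move=> s'; apply: (sum1 (fun j u => a i0 j * U u) [set 0] 0%E j0) => //.
    by move=> j; exact: measurable_funM.
  by move=> s''; exact: (prob_affine_eq0 PU).
Qed.

(** * Hausdorff dimension and random matrices *)

(** A form of the mass distribution principle. A cover of [S] by sets of diameter [d_k <= 1] yields
    a cover of [G] by events of probability at most [(2 d_k)^(m p)], which is at most
    [2^(m p) d_k^s] if [s < m p]. So a vanishing [s]-dimensional measure would force [P G = 0]. *)
Lemma hausdorff_dim_ge (R : realType) (V : normedModType R) (S : set V)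
    d (W : measurableType d) (P : probability W R) (m p : nat)
    (X : W -> 'M[R]_(m, p)) (g : W -> V) (G : set W) :
  (forall i j, measurable_fun setT (fun w => X w i j)) ->
  (forall (T : 'I_m -> 'I_p -> set R) (K : R), (forall i j, measurable (T i j)) ->
     (forall i j, lebesgue_measure (T i j) <= K%:E)%E ->
     (P [set w | forall i j, T i j (X w i j)] <= (K ^+ (m * p))%:E)%E) ->
  (0 < m * p)%N -> measurable G -> (0 < P G)%E -> (forall w, G w -> S (g w)) ->
  (forall w w' i j, `|X w i j - X w' i j| <= `|g w - g w'|) ->
  ((m * p)%:R%:E <= hausdorff_dim S)%E.
Proof.
move=> mX boxX mp0 mG PG GS Xg.
apply: le_ereal_inf_tmp => _ [s [s0 Hs0] <-]; rewrite lee_fin leNgt; apply/negP => smp.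
pose q : R := 2 ^+ (m * p); have q0 : 0 < q by rewrite exprn_gt0.
have PGfin : P G \is a fin_num by rewrite fin_num_measure.
have : (hausdorff_content s 1 S < (fine (P G) / q)%:E)%E.
  apply: (@le_lt_trans _ _ 0%E).
    by rewrite -Hs0; apply: ereal_sup_ubound; exists 1 => //=.
  by rewrite lte_fin divr_gt0// fine_gt0// PG ltey_eq PGfin.
case/ereal_inf_lt => _ [U [SU dU] <-] sumU.
have boxU k : exists (c : 'M[R]_(m, p)) (r : R), [/\ 0 <= r,
    forall w, G w -> U k (g w) -> forall i j, `|X w i j - c i j| <= r
  & ((r ^+ (m * p))%:E <= gauge s (U k))%E].
  have [[w0 Gw0 Uw0]|noG] := pselect (exists2 w, G w & U k (g w)); last first.
    (* A set that misses the image of [G] gets radius 0, whose power [m p > 0] is 0 and hence below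
       any gauge. *)
    exists 0, 0; split => // [w Gw Uw|]; first by case: noG; exists w.
    rewrite expr0n -leqn0 leqNgt mp0 /gauge; case: ifP => // _; exact: poweR_ge0.
  have diam0 w : U k (g w) -> (`|g w - g w0|%:E <= diameter (U k))%E.
    by move=> Uw; apply: ereal_sup_ubound; exists (g w) => //; exists (g w0).
  have d0 := diam0 _ Uw0; rewrite subrr normr0 in d0.
  have d1 := dU k.
  have U0 : (U k == set0) = false by apply/negbTE/set0P; exists (g w0).
  rewrite /gauge U0; case: (diameter (U k)) diam0 d0 d1 => // r diam0.
  rewrite !lee_fin => r0 r1.
  exists (X w0), r; split => //.
    by move=> w Gw Uw i j; rewrite (le_trans (Xg _ _ _ _))// -lee_fin; exact: diam0.
  rewrite poweR_EFin lee_fin.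
  have [->|rn0] := eqVneq r 0; first by rewrite expr0n -leqn0 leqNgt mp0 powR_ge0.
  rewrite -powR_mulrn//; apply: ger_powR; last exact: ltW.
  by rewrite r1 lt_neqAle eq_sym rn0 r0.
have [c /choice[r cr]] := choice boxU.
pose T k i j : set R := `[c k i j - r k, c k i j + r k]%classic.
pose F k := [set w | forall i j, T k i j (X w i j)].
have mF k : measurable (F k).
  have -> : F k = \big[setI/setT]_i \big[setI/setT]_j ((fun w => X w i j) @^-1` T k i j).
    apply/seteqP; split => w; rewrite -bigcap_seq/=.
      by move=> H i _ /=; rewrite -bigcap_seq => j _ /=; exact: H.
    move=> H i j; have := H i; rewrite /= mem_index_enum => /(_ isT).
    by rewrite -bigcap_seq => /(_ j); apply; rewrite /= mem_index_enum.
  apply: bigsetI_measurable => i _; apply: bigsetI_measurable => j _.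
  by rewrite -[X in measurable X]setTI; apply: mX => //; exact: measurable_itv.
have PF k : (P (F k) <= q%:E * gauge s (U k))%E.
  have [r0 _ rg] := cr k.
  apply: (@le_trans _ _ ((2 * r k) ^+ (m * p))%:E).
    apply: boxX => i j; first exact: measurable_itv.
    rewrite /T lebesgue_measure_itv/= lte_fin; case: ifPn => _.
      by rewrite -EFinB lee_fin; lra.
    by rewrite lee_fin mulr_ge0.
  by rewrite exprMn EFinM lee_pmul2l// lte_fin.
have GF : G `<=` \bigcup_k F k.
  move=> w Gw; have [k _ Uk] := SU _ (GS _ Gw); exists k => // i j.
  have [_ cw _] := cr k; rewrite /T/= in_itv/= -ler_distlC distrC; exact: cw.
have : (P G <= q%:E * \sum_(0 <= k <oo) gauge s (U k))%E.
  apply: (@le_trans _ _ (\sum_(0 <= k <oo) P (F k))%E).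
    exact: measure_sigma_subadditive.
  rewrite -nneseriesZl//; last by move=> k _; rewrite /gauge; case: ifP => // _; exact: poweR_ge0.
  by apply: lee_nneseries => // k _; exact: PF.
apply/negP; rewrite -ltNge -[P G]fineK//.
have -> : fine (P G) = q * (fine (P G) / q) by rewrite mulrC divfK// gt_eqF.
by rewrite EFinM lte_pmul2l// lte_fin.
Qed.

(** * Construction of the first two columns *)

Section plane.
Variable K : comPzRingType.
Implicit Types u v x w : 'cV[K]_2.

Definition det2 x w : K := x 0 0 * w 1 0 - x 1 0 * w 0 0.

Lemma det2xx x : det2 x x = 0.
Proof. by rewrite /det2 mulrC subrr. Qed.

Lemma det2Dl u v w : det2 (u + v) w = det2 u w + det2 v w.
Proof. by rewrite /det2 !mxE; ring. Qed.

Lemma det2Zl a v w : det2 (a *: v) w = a * det2 v w.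
Proof. by rewrite /det2 !mxE; ring. Qed.

Lemma det2Dr u v w : det2 w (u + v) = det2 w u + det2 w v.
Proof. by rewrite /det2 !mxE; ring. Qed.

Lemma det2Zr a v w : det2 w (a *: v) = a * det2 w v.
Proof. by rewrite /det2 !mxE; ring. Qed.

Lemma det2C v w : det2 v w = - det2 w v.
Proof. by rewrite /det2; ring. Qed.

Lemma cV2P u v : u 0 0 = v 0 0 -> u 1 0 = v 1 0 -> u = v.
Proof.
move=> h0 h1; apply/colP => i.
by case: (unliftP 0 i) => [j ->|->//]; rewrite ord1; have -> : lift 0 0 = 1 :> 'I_2 by apply/val_inj.
Qed.

Lemma cramer2 x w v : det2 x w *: v = det2 v w *: x + det2 x v *: w.
Proof. by apply: cV2P; rewrite /det2 !mxE; ring. Qed.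

Definition perp x : 'rV[K]_2 := \row_j (if j == 0 then x 1 0 else - x 0 0).

Lemma perpE x v : perp x *m v = (det2 v x)%:M.
Proof.
apply/matrixP => i j; rewrite !ord1 mxE !big_ord_recl big_ord0 !mxE /= addr0.
have -> : lift 0 0 = 1 :> 'I_2 by apply/val_inj.
by rewrite /det2; ring.
Qed.

End plane.

Notation iv := (map_mx intr).

Section integer_vectors.
Variable R : realType.

Lemma iv_inj d (u v : 'cV[int]_d) : iv u = iv v :> 'cV[R]_d -> u = v.
Proof.
move=> /matrixP uv; apply/matrixP => i j.
by have := uv i j; rewrite !mxE => /intr_inj.
Qed.

Lemma ivD d (u v : 'cV[int]_d) : iv (u + v) = iv u + iv v :> 'cV[R]_d.
Proof. exact: map_mxD. Qed.

Lemma ivB d (u v : 'cV[int]_d) : iv (u - v) = iv u - iv v :> 'cV[R]_d.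
Proof. exact: map_mxB. Qed.

Lemma ivZ d (a : int) (v : 'cV[int]_d) : iv (a *: v) = a%:~R *: iv v :> 'cV[R]_d.
Proof. exact: map_mxZ. Qed.

Lemma iv0 d : iv 0 = 0 :> 'cV[R]_d.
Proof. exact: map_mx0. Qed.

Lemma det2_iv (x w : 'cV[int]_2) : det2 (iv x) (iv w) = (det2 x w)%:~R :> R.
Proof. by rewrite /det2 !mxE !(rmorphB, rmorphM). Qed.

Definition integral_vec d (u : 'cV[R]_d) : Prop := exists y : 'cV[int]_d, u = iv y.

Lemma integral_vecD d (u v : 'cV[R]_d) :
  integral_vec u -> integral_vec v -> integral_vec (u + v).
Proof. by move=> [y ->] [z ->]; exists (y + z); rewrite ivD. Qed.

Lemma integral_vecZ d (a : int) (u : 'cV[R]_d) :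
  integral_vec u -> integral_vec (a%:~R *: u).
Proof. by move=> [y ->]; exists (a *: y); rewrite ivZ. Qed.

Lemma det2_le (u v : 'cV[R]_2) (a b : R) : `|u| <= a -> `|v| <= b ->
  `|det2 u v| <= 2 * (a * b).
Proof.
move=> /cV_entry_le ua /cV_entry_le vb.
rewrite /det2 (le_trans (ler_normB _ _))// !normrM mulr2n mulrDl mul1r.
by rewrite lerD// ler_pM.
Qed.

(** The intervals [[a k - 2 t k, a k + 2 t k]] are nested because [t] at least halves; the supremum
    of the left endpoints lies in all of them. *)
Lemma nested_limit (a t : nat -> R) : (forall k, `|a k.+1 - a k| <= t k) ->
  (forall k, t k.+1 <= t k / 2) -> exists l, forall k, `|l - a k| <= 2 * t k.
Proof.
move=> at1 t2.
pose L k := a k - 2 * t k; pose U k := a k + 2 * t k.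
have t0 k : 0 <= t k by exact: le_trans (at1 k).
have Lm : {homo L : i j / (i <= j)%N >-> i <= j}.
  apply: homo_leq => // [? ? ? |k]; first exact: le_trans.
  by have := at1 k; have := t2 k; rewrite ler_norml /L; lra.
have Um : {homo U : i j / (i <= j)%N >-> j <= i}.
  apply: homo_leq => // [? ? ? h1 h2|k]; first exact: le_trans h2 h1.
  by have := at1 k; have := t2 k; rewrite ler_norml /U; lra.
have LU i j : L i <= U j.
  have := Lm _ _ (leq_maxl i j); have := Um _ _ (leq_maxr i j).
  by have := t0 (maxn i j); rewrite /L /U; lra.
exists (sup (range L)) => k; rewrite ler_distl; apply/andP; split.
  by apply: ub_le_sup; [exists (U 0) => _ [i _ <-]|exists k].
by apply: ge_sup; [exists (L 0%N); exists 0%N|move=> _ [i _ <-]; exact: LU].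
Qed.

End integer_vectors.

(** * Lattices of integer vectors with integral image *)

Section sublattice.
Variables (R : realType) (m : nat).
Implicit Types (A : 'M[R]_(m, 2)) (x w v : 'cV[int]_2).

(** The vectors [v] with [A v] integral form a lattice. Two independent ones force [A] to be
    rational, and the determinant of the basis is then a common denominator of all [A v]. *)
Definition sublattice_basis A x w : Prop :=
  [/\ integral_vec (A *m iv x), integral_vec (A *m iv w), det2 x w != 0
    & forall v, integral_vec (A *m iv v) -> exists j u : int, v = j *: x + u *: w].

Lemma integral_vec_mulmxD A u v : integral_vec (A *m iv u) ->
  integral_vec (A *m iv v) -> integral_vec (A *m iv (u + v)).
Proof. by move=> hu hv; rewrite ivD mulmxDr; exact: integral_vecD. Qed.

Lemma integral_vec_mulmxZ A (a : int) v : integral_vec (A *m iv v) ->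
  integral_vec (A *m iv (a *: v)).
Proof. by move=> hv; rewrite ivZ -scalemxAr; exact: integral_vecZ. Qed.

Lemma integral_det2_mul A x w v : sublattice_basis A x w ->
  integral_vec ((det2 x w)%:~R *: (A *m iv v)).
Proof.
move=> [hx hw _ _]; rewrite scalemxAr -ivZ cramer2.
by apply: integral_vec_mulmxD; exact: integral_vec_mulmxZ.
Qed.

(** Among the lattice vectors not parallel to [x], [w] minimises [|det2 x w|]. Division with
    remainder reduces any [v] modulo [w] to a multiple of [x], and this multiple is integral since
    no nonzero lattice vector is shorter than [x]. *)
Lemma exists_sublattice_basis (N : 'cV[R]_2 -> R) A x v0 : is_norm N ->
  integral_vec (A *m iv x) -> integral_vec (A *m iv v0) -> det2 x v0 != 0 ->
  (forall v, v != 0 -> N (iv v) < N (iv x) -> ~ integral_vec (A *m iv v)) ->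
  exists w, sublattice_basis A x w.
Proof.
move=> nN hx hv0 dv0 xmin.
pose Q d := `[<exists v, [/\ integral_vec (A *m iv v), (0 < d)%N & `|det2 x v|%N = d]>].
have exQ : exists d, Q d by exists `|det2 x v0|%N; apply/asboolP; exists v0; rewrite absz_gt0.
case: (ex_minnP exQ) => d /asboolP[w [hw d0 xwd]] dmin.
have dxw : det2 x w != 0 by rewrite -absz_gt0 xwd.
exists w; split => // v hv.
pose u := (det2 x v %/ det2 x w)%Z; pose s := v - u *: w.
have hs : integral_vec (A *m iv s).
  by rewrite /s -scaleNr; apply: integral_vec_mulmxD => //; exact: integral_vec_mulmxZ.
have dsE : det2 x s = (det2 x v %% det2 x w)%Z.
  rewrite /s -scaleNr det2Dr det2Zr {1}(divz_eq (det2 x v) (det2 x w)) -/u.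
  by rewrite addrAC mulNr subrr add0r.
have ds0 : det2 x s = 0.
  apply/eqP; apply: contraT => ds; have /dmin : Q `|det2 x s|%N.
    by apply/asboolP; exists s; rewrite absz_gt0.
  rewrite -xwd leqNgt dsE.
  have := modz_ge0 (det2 x v) dxw; have := ltz_mod (det2 x v) dxw.
  by move=> h1 h2; rewrite -ltz_nat gez0_abs // abszE h1.
suff [j sj] : exists j : int, s = j *: x by exists j, u; rewrite -sj /s subrK.
have x0 : x != 0.
  by apply: contra_neq dv0 => ->; rewrite /det2 !mxE !mul0r subrr.
have sc (b : R) (u' : 'cV[R]_2) l : (b *: u') l 0 = b * u' l 0 by rewrite mxE.
have [al sal] : exists al : R, iv s = al *: iv x.
  have : det2 (iv x) (iv s) = 0 :> R by rewrite det2_iv ds0.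
  have [x00|x00] := eqVneq (iv x 0 0 : R) 0; last first.
    move=> /eqP; rewrite subr_eq0 => /eqP E.
    exists (iv s 0 0 / iv x 0 0); apply: cV2P; rewrite sc.
      by rewrite -[in RHS]mulrA mulVf// mulr1.
    by apply: (mulfI x00); rewrite E; field.
  have x10 : iv x 1 0 != 0 :> R.
    apply: contra_neq x0 => x10; apply: (@iv_inj R); apply: cV2P => //.
      by rewrite x00 iv0 mxE.
    by rewrite x10 iv0 mxE.
  move=> /eqP; rewrite subr_eq0 => /eqP E.
  exists (iv s 1 0 / iv x 1 0); apply: cV2P; rewrite sc.
    by apply: (mulfI x10); rewrite -E; field.
  by rewrite -[in RHS]mulrA mulVf// mulr1.
(* Otherwise [s - j x] would be a nonzero lattice vector of norm [(al - j) N x < N x]. *)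
pose j := Num.floor al; exists j; apply/eqP; rewrite -subr_eq0.
apply: contraT => sj0; exfalso.
have hsj : integral_vec (A *m iv (s - j *: x)).
  by rewrite -scaleNr; apply: integral_vec_mulmxD => //; exact: integral_vec_mulmxZ.
apply: xmin hsj => //; have [N0 NZ _] := nN.
have -> : iv (s - j *: x) = (al - j%:~R) *: iv x by rewrite ivB ivZ sal scalerBl.
have /andP[f1 f2] := floor_itv al.
have Nx0 : 0 < N (iv x).
  rewrite lt_neqAle is_norm_ge0// andbT eq_sym; apply: contra_neq x0 => /N0 x0.
  by apply: (@iv_inj R); rewrite x0 iv0.
rewrite NZ ger0_norm ?subr_ge0// gtr_pMl//.
by move: f2; rewrite rmorphD/= -/j ltrBlDl.
Qed.

End sublattice.

(** * One step of the construction *)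

Section step.
Variables (R : realType) (m : nat) (N : 'cV[R]_2 -> R) (N2 : 'cV[R]_m -> R).
Variables k1 k2 : R.
Hypotheses (nN : is_norm N) (nN2 : is_norm N2).
Hypotheses (k1_gt0 : 0 < k1) (k1N : forall x, k1 * `|x| <= N x).
Hypotheses (k2_gt0 : 0 < k2) (k2N : forall x, k2 * `|x| <= N2 x).
Implicit Types (A : 'M[R]_(m, 2)) (x w v : 'cV[int]_2) (i : 'I_m).

Definition ecol i : 'cV[R]_m := delta_mx i 0.

(* The linear form v |-> det2 v x vanishes at x, so that A x is not changed. *)
Definition update A (mu : R) i x : 'M[R]_(m, 2) := A + mu *: (ecol i *m perp (iv x)).

Lemma updateE A mu i x v :
  update A mu i x *m iv v = A *m iv v + (mu * (det2 v x)%:~R) *: ecol i.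
Proof.
rewrite /update mulmxDl -scalemxAl -mulmxA perpE det2_iv.
by rewrite mul_mx_scalar scalerA.
Qed.

Lemma norm_ecol_ge i : k2 <= N2 (ecol i).
Proof.
apply: le_trans (k2N _); rewrite ler_peMr ?(ltW k2_gt0)//.
by have := cV_entry_le (lexx `|ecol i|) i; rewrite mxE !eqxx normr1.
Qed.

Lemma norm_ge_entry (u : 'cV[R]_m) l : k2 * `|u l 0| <= N2 u.
Proof. by rewrite (le_trans _ (k2N _))// ler_pM2l// cV_entry_le. Qed.

(* D (A v + y) is an integer vector.  If it vanishes, then v = r x + u x' and the
   update adds r/M times a basis vector, with r <> 0 as v is shorter than x';
   otherwise A v + y has an entry of size at least 1/|D|, which the update can
   only halve. *)
Lemma update_isolated A x w (n0 M : nat) i : sublattice_basis A x w -> (0 < M)%N ->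
  let D := det2 x w in let x' := n0%:Z *: x + w in
  let eps := N2 (ecol i) / M%:R in
  4 * N (iv x') ^+ 2 <= k1 ^+ 2 * M%:R ->
  2 * `|D%:~R| * eps <= k2 ->
  forall v y, v != 0 -> N (iv v) < N (iv x') ->
  eps <= N2 (update A (M%:R * D%:~R)^-1 i x' *m iv v + iv y).
Proof.
move=> bA M0 D x' eps hM heps v y v0 vT.
have [_ _ D0 basis] := bA; set T := N (iv x') in hM vT.
have M0' : 0 < M%:R :> R by rewrite ltr0n.
have D0' : D%:~R != 0 :> R by rewrite intr_eq0.
have [z zE] : integral_vec (D%:~R *: (A *m iv v + iv y)).
  by rewrite scalerDr; apply: integral_vecD; [exact: integral_det2_mul bA|exact: integral_vecZ (ex_intro _ y erefl)].
rewrite updateE addrAC; set f := _ * _.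
have [z0|/eqP/colP z0] := eqVneq z 0.
  have Avy : A *m iv v + iv y = 0.
    have : D%:~R *: (A *m iv v + iv y) = 0 by rewrite zE z0 iv0.
    by move/eqP; rewrite scaler_eq0 (negbTE D0') => /eqP.
  have [j [u vE]] : exists j u : int, v = j *: x + u *: w.
    by apply: basis; exists (- y); rewrite map_mxN; apply/eqP; rewrite -addr_eq0 Avy.
  have dvx' : det2 v x' = (j - u * n0%:Z) * D.
    rewrite vE /x' !(det2Dl, det2Dr, det2Zl, det2Zr) !det2xx [det2 w x]det2C /D; ring.
  have fE : f = (j - u * n0%:Z)%:~R / M%:R.
    by rewrite /f dvx' intrM; field; rewrite D0' gt_eqF.
  have [_ NZ _] := nN2.
  rewrite Avy add0r NZ fE normrM normfV (ger0_norm (ltW M0')) mulrAC -mulrA -/eps.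
  rewrite ler_peMl//; first by rewrite divr_ge0 ?is_norm_ge0// ltW.
  rewrite -intr_norm ler1z -gtz0_ge1 normr_gt0.
  (* A zero coefficient would make [v] a nonzero integer multiple of [x'], hence no shorter than
     [x']. *)
  apply: contraTneq vT => ju; rewrite -leNgt.
  have vE' : v = u *: x'.
    by rewrite vE /x' scalerDr scalerA -{1}[j](subrK (u * n0%:Z)) ju add0r.
  have [_ NZ1 _] := nN.
  rewrite vE' ivZ NZ1 ler_peMl ?is_norm_ge0// -intr_norm ler1z -gtz0_ge1 normr_gt0.
  by apply: contra_neq v0 => u0; rewrite vE' u0 scale0r.
have [l zl] : exists l, z l 0 != 0.
  apply: contrapT => nz; apply: z0 => l; rewrite mxE; apply: contrapT => zl.
  by apply: nz; exists l; apply/eqP.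
have D0n : 0 < `|D%:~R| :> R by rewrite normr_gt0.
apply: le_trans (norm_ge_entry _ l).
have zl1 : 1 <= `|D%:~R| * `|(A *m iv v + iv y) l 0|.
  rewrite -normrM; have /matrixP/(_ l 0) := zE; rewrite mxE => ->.
  by rewrite mxE -intr_norm ler1z -gtz0_ge1 normr_gt0.
(* [v] and [x'] have entries at most [T / k1], so their determinant is at most [2 (T / k1)^2], which
   is at most [M / 2] by [hM]. *)
have fle : `|D%:~R| * `|f| <= 1 / 2.
  have -> : `|D%:~R| * `|f| = `|(det2 v x')%:~R| / M%:R :> R.
    rewrite /f normrM normfV normrM (ger0_norm (ltW M0')); field.
    by rewrite !gt_eqF.
  rewrite -det2_iv ler_pdivrMr//.
  apply: le_trans (det2_le (a := T / k1) (b := T / k1) _ _) _.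
  - by rewrite ler_pdivlMr// mulrC (le_trans (k1N _))// ltW.
  - by rewrite ler_pdivlMr// mulrC.
  rewrite -expr2 expr_div_n mulrA ler_pdivrMr ?exprn_gt0//; nra.
have := ler_normB ((A *m iv v + iv y) l 0 + f * ecol i l 0) (f * ecol i l 0).
rewrite addrK => tri.
have e1 : `|f * ecol i l 0| <= `|f|.
  by rewrite normrM ler_piMr// mxE; case: (_ && _); rewrite ?normr1 ?normr0.
have -> : (A *m iv v + iv y + f *: ecol i) l 0 = (A *m iv v + iv y) l 0 + f * ecol i l 0.
  by rewrite mxE [X in _ + X]mxE.
move: tri zl1 fle e1 heps; rewrite -/D.
move: (`|_ + f * _|) (`|(_ + _ : 'cV_m) l 0|) `|f| `|f * _| => X Y F G tri zl1 fle e1 heps.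
have d1 := ler_wpM2l (ltW D0n) tri; have d2 := ler_wpM2l (ltW D0n) e1.
have d3 : 1 / 2 <= `|D%:~R| * X by rewrite mulrDr in d1; lra.
have d4 := ler_wpM2l (ltW k2_gt0) d3.
by clearbody eps; rewrite -(ler_pM2l D0n); lra.
Qed.

Variables (C2 a : R).
Hypotheses (C2_gt0 : 0 < C2) (a_ge2 : 2 <= a).

(* The tolerance t bounds the next change of A; as tolerances at least halve,
   all later changes together are at most 2 t. *)
Record step (c : R) (k : nat) i A x (t : R) A' x' (t' eps : R) : Prop := Step {
  step_eps : 0 < eps;
  step_growth : k.+1%:R * (1 + N (iv x)) <= N (iv x');
  step_ub : eps * N (iv x') `^ a <= c;
  step_lb : c * (1 - k.+1%:R^-1) <= eps * N (iv x') `^ a;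
  step_val : exists y, N2 (A' *m iv x + iv y) = eps;
  step_iso : forall v y, v != 0 -> N (iv v) < N (iv x') ->
    eps <= N2 (A' *m iv v + iv y);
  step_close : forall l j, `|A' l j - A l j| <= t;
  step_t_gt0 : 0 < t';
  step_t_half : t' <= t / 2;
  step_tail : t' * (4 * C2 * N (iv x') * k.+1%:R) <= eps * k1;
  step_den : exists D : nat, [/\ (0 < D)%N,
    forall v, integral_vec (D%:R *: (A' *m iv v)) & t' * (D * k.+1)%:R <= 1];
  step_update : exists2 mu, mu != 0 & A' = update A mu i x';
  step_det : det2 x x' != 0 }.

(** The choice [mu = 1/(M D)] moves [A x] off the integers by exactly [1/M] times a basis vector.
    Hence [M x] and [x'] have integral images under [A'], and a new basis exists. *)
Lemma exists_step c k i A x w t : sublattice_basis A x w -> 0 < t -> 0 < c ->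
  4 * c <= k1 ^+ 2 * k2 ->
  exists A' x' w' t' eps, step c k i A x t A' x' t' eps /\ sublattice_basis A' x' w'.
Proof.
move=> bA t0 c0 hc; have [hx hw D0 basis] := bA.
set D := det2 x w in D0; have D0' : D%:~R != 0 :> R by rewrite intr_eq0.
have D1 : 1 <= `|D%:~R| :> R by rewrite -intr_norm ler1z -gtz0_ge1 normr_gt0.
set nu := N2 (ecol i); have nuk : k2 <= nu by exact: norm_ecol_ge.
have nu0 : 0 < nu by exact: lt_le_trans nuk.
have x0 : x != 0.
  by apply: contra_neq D0 => x0; rewrite /D x0 /det2 !mxE !mul0r subrr.
have [N0 NZ ND] := nN.
have Nx0 : 0 < N (iv x).
  rewrite lt_neqAle is_norm_ge0// andbT eq_sym; apply: contra_neq x0 => /N0 x0.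
  by apply: (@iv_inj R); rewrite x0 iv0.
pose K : R := k.+1%:R; have K1 : 1 <= K by rewrite ler1n.
have large T0 : exists n0 : nat, T0 <= N (iv (n0%:Z *: x + w)).
  pose q := (T0 + N (iv w)) / N (iv x); exists (Num.truncn q).+1.
  have qn : q < (Num.truncn q).+1%:R by exact: truncnS_gt.
  set n := (Num.truncn q).+1 in qn *.
  have := ND (iv (n%:Z *: x + w)) (- iv w).
  rewrite ivD addrK is_normN// ivZ NZ normr_nat => H.
  move: qn; rewrite ltr_pdivrMr// => qn.
  by apply: ltW; rewrite -(ltrD2r (N (iv w))) (lt_le_trans qn).
(* Thresholds for the length of [x']: [T1] gives the growth, [T2] keeps the rounding loss in [M]
   below a share [1/K], [T3] makes [eps] small enough for isolation, [T4] keeps the change of [A]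
   within [t]. *)
pose T1 := K * (1 + N (iv x)); pose T2 := K * c / nu.
pose T3 := 2 * `|D%:~R| * c / k2; pose T4 := c / (k1 * nu * t).
have pos4 : [/\ 0 <= T1, 0 <= T2, 0 <= T3 & 0 <= T4].
  by split; rewrite /T1 /T2 /T3 /T4 ?divr_ge0 ?mulr_ge0 ?addr_ge0// ltW.
have [n0 hn0] := large (T1 + T2 + T3 + T4).
pose x' := n0%:Z *: x + w; set T := N (iv x') in hn0.
have [T1T T2T T3T T4T] : [/\ T1 <= T, T2 <= T, T3 <= T & T4 <= T].
  by case: pos4 => ? ? ? ?; split; lra.
have T_ge1 : 1 <= T by apply: le_trans T1T; rewrite /T1; nra.
have T_gt0 : 0 < T by exact: lt_le_trans T_ge1.
set P := T `^ a; have TP : T ^+ 2 <= P.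
  by rewrite -powR_mulrn ?(ltW T_gt0)//; apply: ler_powR.
have TP1 : T <= P by apply: le_trans TP; rewrite ler_eXnr.
have P0 : 0 < P by exact: lt_le_trans TP1.
(* With [Z] in place of [M] the product [eps P] would be exactly [c]; [M] is the next larger
   integer. *)
pose Z := nu * P / c; have Z0 : 0 < Z by rewrite !(divr_gt0, mulr_gt0).
have ZE : c * Z = nu * P by rewrite /Z; field; rewrite gt_eqF.
pose M := (Num.truncn Z).+1.
have MZ : Z < M%:R by exact: truncnS_gt.
have ZM : M%:R <= Z + 1 by rewrite -natr1 lerD2r truncn_le// ltW.
have M0 : 0 < M%:R :> R by rewrite ltr0n.
pose eps := nu / M%:R; have eps0 : 0 < eps by rewrite divr_gt0.
pose mu : R := (M%:R * D%:~R)^-1.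
have mu0 : mu != 0 by rewrite invr_eq0 mulf_neq0// gt_eqF.
pose A' := update A mu i x'.
have dxx' : det2 x x' = D by rewrite /x' det2Dr det2Zr det2xx mulr0 add0r.
(* The assumption [a >= 2] enters through [T ^+ 2 <= P], combined with the upper bound on [c]. *)
have hM : 4 * T ^+ 2 <= k1 ^+ 2 * M%:R.
  have h1 : 4 * c * Z <= k1 ^+ 2 * k2 * Z by rewrite ler_pM2r.
  have h2 : k1 ^+ 2 * k2 * Z <= k1 ^+ 2 * nu * Z.
    by rewrite ler_pM2r// ler_pM2l// exprn_gt0.
  have h3 : 4 * nu * T ^+ 2 <= 4 * nu * P by rewrite ler_pM2l// mulr_gt0.
  have h4 : k1 ^+ 2 * nu * Z <= k1 ^+ 2 * nu * M%:R.
    by rewrite ler_pM2l ?(ltW MZ)// mulr_gt0// exprn_gt0.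
  rewrite -(ler_pM2l nu0); have h5 : c * Z = nu * P := ZE; have h6 := congr1 ( *%R 4) h5; lra.
have epsc : eps * P <= c.
  by rewrite /eps mulrAC ler_pdivrMr// -ZE ler_pM2l// ltW.
have epsT : eps * T <= c by rewrite (le_trans _ epsc)// ler_pM2l.
have heps : 2 * `|D%:~R| * eps <= k2.
  move: T3T; rewrite /T3 ler_pdivrMr// => T3T.
  have h : 2 * `|D%:~R| * (eps * T) <= 2 * `|D%:~R| * c by rewrite ler_wpM2l.
  rewrite -(ler_pM2r T_gt0) [leRHS]mulrC; apply: le_trans T3T.
  by rewrite -[leLHS]mulrA.
have iso v y : v != 0 -> N (iv v) < T -> eps <= N2 (A' *m iv v + iv y).
  by move=> v0 vT; apply: (update_isolated bA).
have hx' : integral_vec (A' *m iv x').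
  rewrite updateE det2xx mulr0 scale0r addr0 /x'.
  by apply: integral_vec_mulmxD => //; exact: integral_vec_mulmxZ.
have muD : mu * D%:~R = M%:R^-1.
  by rewrite /mu; field; rewrite D0' gt_eqF.
have hMx : integral_vec (A' *m iv (M%:Z *: x)).
  rewrite updateE det2Zl dxx' intrM mulrCA muD mulfV ?gt_eqF// scale1r.
  apply: integral_vecD; first exact: integral_vec_mulmxZ.
  by exists (delta_mx i 0); rewrite map_delta_mx.
have [w' bA'] : exists w', sublattice_basis A' x' w'.
  apply: (exists_sublattice_basis nN hx' hMx).
    by rewrite det2Zr det2C dxx' mulf_neq0// oppr_eq0.
  move=> v v0 vT [y yE]; have := iso v (- y) v0 vT.
  by rewrite yE map_mxN subrr is_norm0// leNgt eps0.
pose D' := `|det2 x' w'|%N.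
have D'0 : (0 < D')%N by rewrite absz_gt0; case: bA'.
have pos : 0 < 4 * C2 * T * K by rewrite !mulr_gt0// (lt_le_trans ltr01).
have posD : 0 < (D' * k.+1)%:R :> R by rewrite ltr0n muln_gt0 D'0.
(* The three terms secure the halving, the control of later changes by [eps], and the comparison
   with the denominator [D']. *)
pose t' := Num.min (t / 2) (Num.min (eps * k1 / (4 * C2 * T * K)) (D' * k.+1)%:R^-1).
exists A', x', w', t', eps; split => //; split => //.
- rewrite -/T -/P -/K /eps mulrAC ler_pdivlMr// -ZE -mulrA ler_pM2l//.
  have KZ : K <= Z.
    rewrite /Z ler_pdivlMr//; move: T2T; rewrite /T2 ler_pdivrMr// => T2T.
    by rewrite (le_trans T2T)// mulrC ler_pM2l.
  have Ki : 0 <= K^-1 <= 1 by rewrite invr_ge0 invf_le1 ?(lt_le_trans ltr01)//; rewrite K1 (le_trans ler01).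
  have KK : 1 <= K^-1 * Z by rewrite mulrC ler_pdivlMr ?mul1r// (lt_le_trans ltr01).
  move: (K^-1) Ki KK => h /andP[h0 h1] KK.
  rewrite -subr_ge0 in h1; have h2 := ler_wpM2l h1 ZM.
  by rewrite (le_trans h2)//; lra.
- have [y0 y0E] := hx; exists (- y0).
  rewrite updateE y0E dxx' muD map_mxN addrAC subrr add0r.
  by have [_ NZ2 _] := nN2; rewrite NZ2 normfV (ger0_norm (ltW M0)) mulrC.
- move=> l j; rewrite /A' /update mxE addrAC subrr add0r mxE.
  have -> : (ecol i *m perp (iv x')) l j = (l == i)%:R * perp (iv x') 0 j.
    by rewrite mxE big_ord1 mxE andbT.
  have pj : `|(l == i)%:R * perp (iv x') 0 j| <= T / k1.
    have xT : `|iv x' : 'cV[R]_2| <= T / k1 by rewrite ler_pdivlMr// mulrC.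
    have := cV_entry_le xT => xe.
    have Tk : 0 <= T / k1 by rewrite divr_ge0// ltW.
    case: (l == i); last by rewrite mul0r normr0.
    by rewrite mul1r mxE; case: ifP => _; rewrite ?normrN; exact: xe.
  rewrite normrM; apply: (@le_trans _ _ (M%:R^-1 * (T / k1))).
    apply: ler_pM => //; rewrite /mu normfV normrM (ger0_norm (ltW M0)).
    by rewrite lef_pV2 ?posrE ?mulr_gt0 ?normr_gt0// ler_peMr// ltW.
  move: T4T; rewrite /T4 ler_pdivrMr ?mulr_gt0// => T4T.
  rewrite mulrC ler_pdivrMr// ler_pdivrMr//.
  have h1 : nu * T * T <= c * M%:R.
    rewrite -mulrA -expr2 (@le_trans _ _ (nu * P))// ?ler_pM2l//.
    by rewrite -ZE ler_pM2l// ltW.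
  have h2 : c * M%:R <= T * (k1 * nu * t) * M%:R by rewrite ler_pM2r.
  rewrite -(ler_pM2l (mulr_gt0 nu0 T_gt0)); nra.
- by rewrite !lt_min !divr_gt0//= ?mulr_gt0// invr_gt0.
- by rewrite ge_min lexx.
- by rewrite -ler_pdivlMr//; rewrite !ge_min lexx orbT.
- exists D'; split => //; last by rewrite -ler_pdivlMr// mul1r !ge_min lexx !orbT.
  move=> v; have := integral_det2_mul v bA'.
  rewrite /D' -[`|_|%N%:R]/(`|_|%N%:Z%:~R) abszE.
  case: (ger0P (det2 x' w')) => [//|_] /(integral_vecZ (-1)).
  by rewrite scalerA rmorphN mulN1r -rmorphN.
- by exists mu.
- by rewrite dxx'.
Qed.

End step.

(** The steps are iterated and [A] is their limit; later changes affect the values by at most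
    [eps k / (k + 1)]. For the last claim, a relation evaluated at a stage is rational with a known
    denominator, and too small to be nonzero at late stages. *)
Lemma exists_columns (R : realType) (m : nat) (N : 'cV[R]_2 -> R)
    (N2 : 'cV[R]_m -> R) (a : R) :
  (0 < m)%N -> is_norm N -> is_norm N2 -> 2 <= a ->
  exists2 c0, 0 < c0 & forall c : nat -> R, (forall k, 0 < c k <= c0) ->
  exists (A : 'M[R]_(m, 2)) (x : nat -> 'cV[int]_2) (eps : nat -> R),
  [/\ forall k, [/\ 0 < eps k, k.+1%:R * (1 + N (iv (x k))) <= N (iv (x k.+1)),
        eps k * N (iv (x k.+1)) `^ a <= c k
      & c k * (1 - k.+1%:R^-1) <= eps k * N (iv (x k.+1)) `^ a],
      forall k, exists y, N2 (A *m iv (x k) + iv y) <= eps k * (1 + k.+1%:R^-1),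
      forall k v y, v != 0 -> N (iv v) < N (iv (x k.+1)) ->
        eps k * (1 - k.+1%:R^-1) <= N2 (A *m iv v + iv y)
    & forall (q : 'I_m -> 'I_2 -> int) (q0 : int),
        \sum_i \sum_j (q i j)%:~R * A i j + q0%:~R = 0 -> forall i j, q i j = 0].
Proof.
move=> m0 nN nN2 a2.
have [k1 k10 k1N] := is_norm_ge nN; have [k2 k20 k2N] := is_norm_ge nN2.
have [C2 C20 NC2] := is_norm_le nN2.
exists (k1 ^+ 2 * k2 / 4); first by rewrite divr_gt0// mulr_gt0// exprn_gt0.
move=> c hc.
(* Every row is used twice in succession: a rational relation between the entries
   of A then makes its coefficient vector in that row orthogonal to two consecutive
   x_k, which are not parallel. *)
pose dir k : 'I_m := Ordinal (ltn_pmod k./2 m0).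
pose state := ('M[R]_(m, 2) * 'cV[int]_2 * 'cV[int]_2 * R)%type.
pose good (s : state) := let: (A, x, w, t) := s in sublattice_basis A x w /\ 0 < t.
pose next (ks : nat * state) (se : state * R) := good ks.2 -> good se.1 /\
  let: (A, x, w, t) := ks.2 in let: (A', x', w', t') := se.1 in
  step N N2 k1 C2 a (c ks.1) ks.1 (dir ks.1) A x t A' x' t' se.2.
(* [next] is conditional on a good state, hence total: other states receive a dummy value, and a
   single choice function can be iterated. *)
have [f fP] : {f & forall ks, next ks (f ks)}.
  apply: choice => -[k [[[A x] w] t]].
  have [[bA t0]|nb] := pselect (good (A, x, w, t)); last first.
    by exists (A, x, w, t, 0) => /nb.
  have /andP[ck ck0] := hc k.
  have ck4 : 4 * c k <= k1 ^+ 2 * k2 by rewrite mulrC -ler_pdivlMr.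
  have [A' [x' [w' [t' [e [st bA']]]]]] :=
    exists_step nN nN2 k10 k1N k20 k2N C20 a2 k (dir k) bA t0 ck ck4.
  by exists (A', x', w', t', e) => _; split => //; split => //; case: st.
(* The zero matrix has integral values everywhere, so the standard basis serves at the start. *)
pose s0 : state := (0, delta_mx 0 0, delta_mx 1 0, 1).
pose s := fix s k := if k is k'.+1 then (f (k', s k')).1 else s0.
have gs k : good (s k).
  elim: k => [|k IH]; last by case: (fP (k, s k) IH).
  split => //.
  have i0 : integral_vec (0 : 'cV[R]_m) by exists 0; rewrite iv0.
  split; rewrite ?mul0mx//; first by rewrite /det2 !mxE.
  move=> v _; exists (v 0 0), (v 1 0); apply: cV2P; rewrite !mxE/=; ring.
pose A k := (s k).1.1.1; pose x k := (s k).1.1.2; pose t k := (s k).2.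
pose eps k := (f (k, s k)).2.
have st k : step N N2 k1 C2 a (c k) k (dir k) (A k) (x k) (t k) (A k.+1) (x k.+1) (t k.+1) (eps k).
  have := (fP (k, s k) (gs k)).2.
  rewrite /A /x /t /eps /= -/s; case: (s k) => -[[? ?] ?] ?.
  by case: (f _) => -[[[? ?] ?] ?] ?.
have [L LP] : exists L : 'M[R]_(m, 2), forall k i j, `|L i j - A k i j| <= 2 * t k.
  have /choice[l lP] : forall ij : 'I_m * 'I_2, exists l, forall k, `|l - A k ij.1 ij.2| <= 2 * t k.
    by move=> [i j]; apply: nested_limit => k; [exact: step_close (st k) i j|exact: step_t_half (st k)].
  by exists (\matrix_(i, j) l (i, j)) => k i j; rewrite mxE; exact: lP.
have tail k v : N (iv v) <= N (iv (x k.+1)) ->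
    N2 ((L - A k.+1) *m iv v) <= eps k * k.+1%:R^-1.
  move=> vT; have K0 : 0 < k.+1%:R :> R by rewrite ltr0n.
  have tk0 := step_t_gt0 (st k).
  have vb : `|iv v : 'cV[R]_2| <= N (iv (x k.+1)) / k1.
    by rewrite ler_pdivlMr// mulrC (le_trans (k1N _)).
  have Lb : `|(L - A k.+1) *m iv v| <= 4 * t k.+1 * (N (iv (x k.+1)) / k1).
    have B0 : 0 <= N (iv (x k.+1)) / k1 by rewrite divr_ge0 ?is_norm_ge0// ltW.
    rewrite [leLHS]/Num.norm/= mx_normrE; apply/bigmax_leP; split.
      by rewrite mulr_ge0// mulr_ge0// ltW.
    move=> [i j] _ /=; rewrite mxE !ord1 !big_ord_recl big_ord0 addr0.
    rewrite (le_trans (ler_normD _ _))// !normrM.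
    have e l : `|(L - A k.+1) i l| * `|(iv v : 'cV[R]_2) l 0| <= 2 * t k.+1 * (N (iv (x k.+1)) / k1).
      by apply: ler_pM => //; [rewrite mxE [X in _ + X]mxE; exact: LP|exact: cV_entry_le vb l].
    by apply: (le_trans (lerD (e _) (e _))); rewrite -mulrDl -mulrDl -natrD.
  apply: (le_trans (NC2 _)); rewrite ler_pdivlMr//.
  have := step_tail (st k).
  rewrite -ler_pdivrMr// => h; apply: le_trans h.
  rewrite -(ler_pM2r k10) divfK ?gt_eqF//.
  have h := ler_wpM2l (ltW (mulr_gt0 C20 (mulr_gt0 k10 K0))) Lb.
  have -> : t k.+1 * (4 * C2 * N (iv (x k.+1)) * k.+1%:R) =
     C2 * (k1 * k.+1%:R) * (4 * t k.+1 * (N (iv (x k.+1)) / k1)) by field; rewrite gt_eqF.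
  by apply: le_trans h; rewrite le_eqVlt; apply/orP; left; apply/eqP; ring.
exists L, x, eps; split.
- by move=> k; case: (st k).
- move=> k; have [y yE] := step_val (st k); exists y.
  have -> : L *m iv (x k) + iv y = (A k.+1 *m iv (x k) + iv y) + (L - A k.+1) *m iv (x k).
    rewrite mulmxBl; move: (L *m _) (A _ *m _) (iv y) => b1 b2 b3.
    by apply/matrixP => i j; rewrite !mxE; ring.
  have [_ _ ND] := nN2; rewrite (le_trans (ND _ _))// mulrDr mulr1 yE lerD2l tail//.
  have := step_growth (st k); have := is_norm_ge0 (iv (x k)) nN.
  have : 1 <= k.+1%:R :> R by rewrite ler1n.
  by move: (k.+1%:R) (N _) (N _) => ? ? ?; nra.
- move=> k v y v0 vT.
  have h := step_iso (st k) y v0 vT.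
  have [_ _ ND] := nN2.
  have := ND (L *m iv v + iv y) (- ((L - A k.+1) *m iv v)).
  have -> : (L *m iv v + iv y) - (L - A k.+1) *m iv v = A k.+1 *m iv v + iv y.
    rewrite mulmxBl; move: (L *m _) (A _ *m _) (iv y) => b1 b2 b3.
    by apply/matrixP => i j; rewrite !mxE; ring.
  rewrite is_normN// => h2; have h3 := tail k v (ltW vT).
  by rewrite mulrBr mulr1 lerBlDr (le_trans h)// (le_trans h2)// lerD2l.
- move=> q q0 rel.
  pose rho (B : 'M[R]_(m, 2)) : R := \sum_i \sum_j (q i j)%:~R * B i j + q0%:~R.
  have rhoB B B' : rho B - rho B' = \sum_i \sum_j (q i j)%:~R * (B i j - B' i j).
    rewrite /rho opprD addrACA subrr addr0 -sumrB; apply: eq_bigr => i _.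
    by rewrite -sumrB; apply: eq_bigr => j _; rewrite mulrBr.
  pose H : R := \sum_i \sum_j `|(q i j)%:~R|.
  have H0 : 0 <= H by rewrite sumr_ge0// => i _; rewrite sumr_ge0.
  have rhoA k : `|rho (A k)| <= H * (2 * t k).
    rewrite -[rho (A k)]subr0 -[0]rel rhoB (le_trans (ler_norm_sum _ _ _))// mulr_suml.
    apply: ler_sum => i _; rewrite (le_trans (ler_norm_sum _ _ _))// mulr_suml.
    by apply: ler_sum => j _; rewrite normrM ler_wpM2l// distrC.
  (* [D rho (A k.+1)] is an integer of absolute value at most [2 H / (k + 1)], which is below 1 for
     late [k]. *)
  have [k0 rho0] : exists k0, forall k, (k0 < k)%N -> rho (A k) = 0.
    exists (Num.truncn (2 * H)) => -[//|k] k0k.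
    have [D [D0 hD tD]] := step_den (st k).
    have [z zE] : exists z : int, D%:R * rho (A k.+1) = z%:~R.
      have hA i j : exists z : int, D%:R * A k.+1 i j = z%:~R.
        have [y yE] := hD (delta_mx j 0); exists (y i 0).
        have /matrixP/(_ i 0) := yE; rewrite map_delta_mx -colE !mxE => <-//.
      have /choice[z zE] : forall ij : 'I_m * 'I_2, exists z : int,
          D%:R * A k.+1 ij.1 ij.2 = z%:~R by move=> [i j]; exact: hA.
      exists (\sum_i \sum_j q i j * z (i, j) + D%:Z * q0).
      rewrite mulrDr mulr_sumr rmorphD rmorph_sum rmorphM/=; congr (_ + _).
      apply: eq_bigr => i _; rewrite mulr_sumr rmorph_sum; apply: eq_bigr => j _.
      by rewrite mulrCA (zE (i, j)) [RHS]intrM.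
    have Dpos : 0 < D%:R :> R by rewrite ltr0n.
    suff z0 : z = 0 by move: zE; rewrite z0 => /eqP; rewrite mulf_eq0 gt_eqF//= => /eqP.
    apply/eqP; rewrite -normr_le0 -ltz1D addr0 -(ltr_int R) intr_norm -zE normrM ger0_norm ?ltW//.
    have h1 := ler_wpM2l (ltW Dpos) (rhoA k.+1).
    apply: (le_lt_trans h1).
    have K0 : 0 < k.+1%:R :> R by rewrite ltr0n.
    have hk : 2 * H < k.+1%:R by rewrite -truncn_lt_nat// mulr_ge0.
    rewrite natrM in tD; rewrite -(ltr_pM2r K0) mul1r (le_lt_trans _ hk)//.
    have h2 := ler_wpM2l (mulr_ge0 (ler0n R 2) H0) tD.
    by rewrite mulr1 in h2; apply: le_trans h2; rewrite le_eqVlt; apply/orP; left; apply/eqP; ring.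
  (* Consecutive stages differ only in row [dir k], so subtracting their relations isolates the
     coefficients of that row. *)
  have perp0 k : (k0 < k)%N -> (perp (iv (x k.+1)) *m \col_j (q (dir k) j)%:~R) 0 0 = 0 :> R.
    move=> k0k; have [mu mu0 E] := step_update (st k).
    have := rhoB (A k.+1) (A k); rewrite !rho0// ?(ltn_trans k0k)// subrr.
    rewrite (bigD1 (dir k))//= [X in _ + X]big1 => [|i idir]; last first.
      rewrite big1// => j _; rewrite E /update mxE addrAC subrr add0r !mxE big_ord1 !mxE.
      by rewrite (negbTE idir) mul0r !mulr0.
    rewrite addr0 => /esym/eqP.
    have -> : \sum_j (q (dir k) j)%:~R * (A k.+1 (dir k) j - A k (dir k) j) =
        mu * (perp (iv (x k.+1)) *m \col_j (q (dir k) j)%:~R) 0 0.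
      rewrite mxE mulr_sumr; apply: eq_bigr => j _.
      rewrite E /update mxE addrAC subrr add0r mxE mxE big_ord1 [ecol _ _ _ _]mxE !eqxx mul1r.
      by rewrite [(\col__ _) _ _]mxE; ring.
    by rewrite mulf_eq0 (negbTE mu0) => /eqP.
  move=> i.
  (* Half of [k] is congruent to [i] modulo [m], and [k] is even, so steps [k] and [k + 1] both act
     on row [i]. *)
  pose k := (2 * (m * k0.+1 + i))%N.
  have k0k : (k0 < k)%N by rewrite /k; clear -m0; nia.
  have d1 : dir k = i by apply/val_inj; rewrite /= /k mul2n doubleK [(m * _)%N]mulnC modnMDl modn_small.
  have d2 : dir k.+1 = i.
    by apply/val_inj; rewrite /= /k mul2n uphalf_double [(m * _)%N]mulnC modnMDl modn_small.
  have := perp0 k k0k; have := perp0 k.+1 (ltnW k0k : (k0 < k.+1)%N); rewrite d1 d2.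
  set v : 'cV[R]_2 := \col_j _; rewrite !perpE ![(_%:M) _ _]mxE /= !mulr1n => p2 p1.
  have det0 := step_det (st k.+1).
  have : (det2 (x k.+1) (x k.+2))%:~R *: v = 0.
    by rewrite -det2_iv cramer2 [det2 _ v]det2C p1 p2 oppr0 !scale0r addr0.
  move=> /eqP; rewrite scaler_eq0 intr_eq0 (negbTE det0) /= => /eqP/colP v0 j.
  by have := v0 j; rewrite !mxE => /eqP; rewrite intr_eq0 => /eqP.
Qed.

(** * Evaluation of Theta *)

Section limits_at_pinfty.
Variables (R : realType) (f : R -> \bar R).
Local Open Scope ereal_scope.

Lemma limf_esup_pinfty_le (c : R) :
  (forall e : R, (0 < e)%R -> exists M, forall t, (M < t)%R -> f t <= (c + e)%:E) ->
  limf_esup f (pinfty_nbhs R) <= c%:E.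
Proof.
move=> H; apply/lee_addgt0Pr => e /H[M fM].
apply: (@le_trans _ _ (ereal_sup (f @` [set t | (M < t)%R]))).
  by apply: ereal_inf_lbound; exists [set t | (M < t)%R] => //; exists M; rewrite num_real.
by apply: ge_ereal_sup => _ [t Mt <-]; exact: fM.
Qed.

Lemma limf_esup_pinfty_ge (c : R) :
  (forall e M : R, (0 < e)%R -> exists2 t, (M < t)%R & (c - e)%:E <= f t) ->
  c%:E <= limf_esup f (pinfty_nbhs R).
Proof.
move=> H; apply: le_ereal_inf_tmp => _ [V [M [_ MV]] <-].
apply/lee_addgt0Pr => e /(H _ M)[t Mt ct].
rewrite -leeBlDr// -EFinB (le_trans ct)//.
by apply: ereal_sup_ubound; exists t => //; exact: MV.
Qed.

Lemma limf_einf_pinfty_le (c : R) :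
  (forall e M : R, (0 < e)%R -> exists2 t, (M < t)%R & f t <= (c + e)%:E) ->
  limf_einf f (pinfty_nbhs R) <= c%:E.
Proof.
move=> H; rewrite /limf_einf leeNl; apply: le_ereal_inf_tmp => _ [V [M [_ MV]] <-].
apply/lee_addgt0Pr => e /(H _ M)[t Mt ct].
rewrite -leeBlDr// -EFinN -EFinB -opprD EFinN.
apply: (@le_trans _ _ (- f t)); first by rewrite leeN2.
by apply: ereal_sup_ubound; exists t => //; exact: MV.
Qed.

End limits_at_pinfty.

(** * Bounds for psi and its scaled limits *)

Section theta.
Variables (R : realType) (m p : nat).
Variables (N1 : 'cV[R]_(2 + p) -> R) (N2 : 'cV[R]_m -> R).
Hypotheses (nN1 : is_norm N1) (nN2 : is_norm N2).
Let N (v : 'cV[R]_2) := N1 (col_mx v 0).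
Let a : R := (2 + p)%:R / m%:R.
Hypothesis a_ge2 : 2 <= a.
Variables (A : 'M[R]_(m, 2)) (B : 'M[R]_(m, p)).
Variables (x : nat -> 'cV[int]_2) (eps ck : nat -> R) (c : R).
Hypothesis ck_bounds : forall k, [/\ 0 < ck k, c <= ck k, ck k <= 1 & ck k <= c + k.+1%:R^-1].
Hypothesis eps_bounds : forall k, [/\ 0 < eps k,
  k.+1%:R * (1 + N (iv (x k))) <= N (iv (x k.+1)),
  eps k * N (iv (x k.+1)) `^ a <= ck k
  & ck k * (1 - k.+1%:R^-1) <= eps k * N (iv (x k.+1)) `^ a].
Hypothesis eps_ub : forall k, exists y, N2 (A *m iv (x k) + iv y) <= eps k * (1 + k.+1%:R^-1).
Hypothesis eps_lb : forall k v y, v != 0 -> N (iv v) < N (iv (x k.+1)) ->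
  eps k * (1 - k.+1%:R^-1) <= N2 (A *m iv v + iv y).

Let T k := N (iv (x k)).

Lemma mul_row_mx_iv (v : 'cV[int]_2) (z : 'cV[int]_p) :
  row_mx A B *m iv (col_mx v z) = A *m iv v + B *m iv z.
Proof. by rewrite map_col_mx mul_row_col. Qed.

Let N_ge0 v : 0 <= N v.
Proof. exact: (is_norm_ge0 (col_mx v 0) nN1). Qed.

Let T_ge k : k.+1%:R <= T k.+1.
Proof.
have [_ h _ _] := eps_bounds k; apply: le_trans h.
by rewrite ler_peMr// lerDl N_ge0.
Qed.

Let T_mono k : k.+1%:R * T k <= T k.+1.
Proof. by have [_ h _ _] := eps_bounds k; apply: le_trans h; rewrite ler_wpM2l// lerDr. Qed.

Let h01 k : 0 < (k.+1%:R : R)^-1 <= 1.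
Proof. by rewrite invr_gt0 ltr0Sn invf_le1 ?ltr0Sn// ler1n. Qed.

(** The competitor is [x k] padded with zeros, on which [B] acts trivially. Index 0 is excluded
    because only the later [x k] are known to have norm at least 1. *)
Lemma psi_le k t : (0 < k)%N -> T k <= t ->
  (psi N1 N2 (row_mx A B) t <= (eps k * (1 + k.+1%:R^-1))%:E)%E.
Proof.
case: k => // k _ Tt; have [y yE] := eps_ub k.+1.
apply: le_trans (_ : _ <= (N2 (A *m iv (x k.+1) + iv y))%:E)%E _; last by rewrite lee_fin.
apply: ereal_inf_lbound; exists (col_mx (x k.+1) 0) => /=.
  rewrite map_col_mx map_mx0 Tt andbT (le_trans _ (T_ge k))//.
  by rewrite ler1n.
by exists y => //; rewrite mul_row_mx_iv iv0 mulmx0 addr0.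
Qed.

(** Vectors [(v, z)] with [z != 0] are covered by the hypothesis on [B], those with [z = 0] by the
    isolation bound for [A]. *)
Lemma psi_ge k t : t < T k.+1 ->
  (forall v z y, z != 0 -> N1 (iv (col_mx v z)) <= T k.+1 ->
     eps k <= N2 (A *m iv v + B *m iv z + iv y)) ->
  ((eps k * (1 - k.+1%:R^-1))%:E <= psi N1 N2 (row_mx A B) t)%E.
Proof.
move=> tT good; apply: le_ereal_inf_tmp => _ [b /andP[b1 bt] [y _ <-]].
have bT := le_lt_trans bt tT.
rewrite lee_fin -(vsubmxK b) in b1 bT *.
move: (usubmx b) (dsubmx b) b1 bT => v z b1 bT; rewrite mul_row_mx_iv.
have [eps0 _ _ _] := eps_bounds k.
have [z0|z0] := eqVneq z 0; last first.
  apply: le_trans (good _ _ _ z0 (ltW bT)); apply: ler_piMr; first exact: ltW.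
  by case/andP: (h01 k) => h0 _; rewrite gerBl ltW.
rewrite z0 iv0 mulmx0 addr0; rewrite z0 map_col_mx map_mx0 in b1 bT.
apply: eps_lb => //; apply: contraTneq b1 => ->.
by rewrite map_mx0 col_mx0 is_norm0// ler10.
Qed.

Let T_large (M : R) : exists k0, forall k, (k0 <= k)%N -> M < T k.
Proof.
exists (Num.truncn M).+2 => -[//|k] k0k.
apply: lt_le_trans (T_ge k); rewrite (lt_le_trans (truncnS_gt M))// ler_nat.
by rewrite (leq_trans _ k0k).
Qed.

Let T_homo : {homo T : i j / (i <= j)%N >-> i <= j}.
Proof.
apply: homo_leq => // [? ? ? |k]; first exact: le_trans.
by rewrite (le_trans _ (T_mono k))// ler_peMl ?N_ge0// ler1n.
Qed.

Let small (e : R) : 0 < e -> exists k0, forall k, (k0 <= k)%N -> (k.+1%:R : R)^-1 < e.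
Proof.
move=> e0; exists (Num.truncn e^-1) => k k0k.
rewrite invf_plt ?posrE ?ltr0Sn// (lt_le_trans (truncnS_gt _))//.
by rewrite ler_nat.
Qed.

(** For [T k <= t < T k.+1] the vector [x k] bounds the scaled value by [ck k (1 + 1/(k+1))], which
    is at most [c + 2/(k+1)]. *)
Lemma Theta_le : (Theta N1 N2 (row_mx A B) <= c%:E)%E.
Proof.
apply: limf_esup_pinfty_le => e e0.
have [k0 hk0] : exists k0, forall k, (k0 <= k)%N -> (k.+1%:R : R)^-1 < e / 2.
  by apply: small; rewrite divr_gt0.
exists (T k0.+1) => t Tt.
have [K tK] := T_large t.
have exQ : exists k, t < T k by exists K; exact: tK.
case: (ex_minnP exQ) => k tk kmin.
have k0k : (k0.+1 < k)%N.
  by rewrite ltnNge; apply: contraL tk => kk0; rewrite -leNgt (le_trans (T_homo kk0))// ltW.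
case: k tk kmin k0k => // k tk kmin k0k.
have Tkt : T k <= t by rewrite leNgt; apply/negP => /kmin; rewrite ltnn.
have k_gt0 : (0 < k)%N by exact: leq_ltn_trans (leq0n k0) (k0k : (k0 < k)%N).
have t0 : 0 <= t by exact: le_trans (N_ge0 _) Tkt.
have [eps0 _ ub _] := eps_bounds k; have [ck0 _ ck1 ckc] := ck_bounds k.
have h1 := hk0 k (ltnW (k0k : (k0 < k)%N)); have /andP[h2 h3] := h01 k.
rewrite /scaled_psi; apply: le_trans (lee_wpmul2l _ (psi_le k_gt0 Tkt)) _.
  by rewrite lee_fin powR_ge0.
rewrite -EFinM lee_fin.
apply: (@le_trans _ _ (ck k * (1 + k.+1%:R^-1))).
  rewrite mulrA ler_wpM2r//.
  rewrite mulrC (le_trans _ ub)// ler_wpM2l ?(ltW eps0)//.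
  have a0 : 0 <= a by rewrite (le_trans _ a_ge2).
  by apply: ge0_ler_powR; rewrite ?nnegrE ?N_ge0// ltW.
move: (k.+1%:R^-1) h1 h2 h3 ckc => h h1 h2 h3 ckc; nra.
Qed.

(** At [t = T k] the vector [x k] makes the scaled value of order [1/(k+1)], as
    [T k.+1 >= (k+1) T k] while [eps k] times [T k.+1] to the power [a] is at most 1. *)
Lemma Theta_inf_le0 : (Theta_inf N1 N2 (row_mx A B) <= 0)%E.
Proof.
apply: limf_einf_pinfty_le => e M e0; rewrite add0r.
have [k0 hk0] := small (divr_gt0 e0 (ltr0n R 2)).
have [k1 hk1] := T_large M.
pose k := (k0 + k1).+1; exists (T k).
  by apply: hk1; rewrite /k -addSn leq_addl.
have [eps0 _ ub _] := eps_bounds k; have [ck0 _ ck1 ckc] := ck_bounds k.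
have k0k : (k0 <= k)%N by rewrite /k -addnS leq_addr.
have h1 := hk0 k k0k; have /andP[h2 h3] := h01 k.
rewrite /scaled_psi; apply: le_trans (lee_wpmul2l _ (psi_le (ltn0Sn _) (lexx (T k)))) _.
  by rewrite lee_fin powR_ge0.
rewrite -EFinM lee_fin.
have K1 : 1 <= k.+1%:R :> R by rewrite ler1n.
have Tk : k.+1%:R * T k `^ a <= T k.+1 `^ a.
  apply: (@le_trans _ _ ((k.+1%:R * T k) `^ a)).
    have a1 : 1 <= a by rewrite (le_trans _ a_ge2)// ler1n.
    by apply: le1r_powRZ => //; exact: N_ge0.
  have a0 : 0 <= a by rewrite (le_trans _ a_ge2).
  by apply: ge0_ler_powR => //; rewrite nnegrE ?mulr_ge0 ?N_ge0.
have h4 : T k `^ a * eps k <= k.+1%:R^-1.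
  rewrite -[leRHS]mulr1 ler_pdivlMl ?ltr0Sn// mulrA (le_trans _ ck1)//.
  by rewrite (le_trans _ ub)// mulrC ler_pM2l.
rewrite mulrA; move: (k.+1%:R^-1) (T k `^ a * eps k) h1 h2 h3 h4 => h u h1 h2 h3 h4.
nra.
Qed.

Hypothesis good : forall K, exists2 k, (K <= k)%N &
  forall v z y, z != 0 -> N1 (iv (col_mx v z)) <= T k.+1 ->
    eps k <= N2 (A *m iv v + B *m iv z + iv y).

(** With [h = 1/(k+1)] at a good [k], [t] is taken just below [T k.+1] so that its power [a] loses
    the factor [1 - h]. The bounds for psi and [eps k] cost one such factor each, and
    [(1 - h)^3 >= 1 - 3 h]. *)
Lemma Theta_ge : (c%:E <= Theta N1 N2 (row_mx A B))%E.
Proof.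
apply: limf_esup_pinfty_ge => e M e0.
have [k0 hk0] := small (divr_gt0 e0 (ltr0n R 3)).
have [k1 hk1] := T_large (2 * M).
have [k kk hk] := good (k0 + k1).+1.
have [eps0 _ ub lb] := eps_bounds k; have [ck0 cck ck1 ckc] := ck_bounds k.
have k0k : (k0 <= k)%N by apply: leq_trans kk; rewrite -addnS leq_addr.
have h1 := hk0 k k0k; have /andP[h2 h3] := h01 k.
have k1k : (k1 <= k.+1)%N by apply: leqW; apply: leq_trans kk; rewrite -addSn leq_addl.
have TM := hk1 _ k1k.
have h12 : k.+1%:R^-1 <= 1 / 2 :> R.
  rewrite mul1r lef_pV2 ?posrE ?ltr0Sn// ler_nat ltnS.
  by apply: leq_trans kk.
set h := k.+1%:R^-1 in lb h1 h2 h3 h12 *.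
have a0 : 0 < a by rewrite (lt_le_trans _ a_ge2).
have ai1 : a^-1 <= 1 by rewrite invf_le1// (le_trans _ a_ge2)// ler1n.
have g0 : 0 < 1 - h by lra.
have T0 : 0 < T k.+1 by rewrite (lt_le_trans _ (T_ge k))// ltr0Sn.
pose t := T k.+1 * (1 - h) `^ a^-1.
have tT : t < T k.+1.
  have ai0 : 0 < a^-1 by rewrite invr_gt0.
  have : (1 - h) `^ a^-1 < 1 `^ a^-1.
    by apply: (gt0_ltr_powR ai0); rewrite ?nnegrE ?ler01 ?(ltW g0)//; lra.
  by rewrite powR1 /t gtr_pMr.
have ta : t `^ a = T k.+1 `^ a * (1 - h).
  by rewrite /t powRM ?powR_ge0 ?(ltW T0)// -powRrM mulVf ?gt_eqF// powRr1 ?(ltW g0).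
exists t.
  apply: (@lt_le_trans _ _ (T k.+1 * (1 / 2))); first by lra.
  rewrite /t ler_pM2l// (@le_trans _ _ (1 - h))//; first by lra.
  by apply: ger1_powR => //; rewrite g0; lra.
rewrite /scaled_psi.
apply: le_trans _ (lee_wpmul2l _ (psi_ge tT hk)); last by rewrite lee_fin powR_ge0.
rewrite -EFinM lee_fin -/a ta -/h.
have -> : T k.+1 `^ a * (1 - h) * (eps k * (1 - h)) = (eps k * T k.+1 `^ a) * ((1 - h) * (1 - h)) by ring.
apply: (@le_trans _ _ (ck k * (1 - h) * ((1 - h) * (1 - h)))); last first.
  by rewrite ler_wpM2r// mulr_ge0// ltW.
have h5 : 1 - 3 * h <= (1 - h) * ((1 - h) * (1 - h)) by nra.
have h6 := ler_wpM2l (ltW ck0) h5.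
rewrite -mulrA; nra.
Qed.

End theta.

(** * Proof of the theorem *)

Section probability_bounds.
Context d (W : measurableType d) (R : realType) (P : probability W R).
Local Open Scope ereal_scope.

(** The events [L K], that [F k] occurs for all [k >= K], increase with [K] and have probability at
    most 1/2; by continuity from below so has their union. The null sets [Z k] add nothing. *)
Lemma prob_infinitely_often (F Z : nat -> set W) :
  (forall k, measurable (F k)) -> (forall k, measurable (Z k)) ->
  (forall k, P (F k) <= (1 / 2)%:E) -> (forall k, P (Z k) <= 0) ->
  let G := [set w | (forall K, exists2 k, (K <= k)%N & ~ F k w) /\ forall k, ~ Z k w] in
  measurable G /\ 0 < P G.
Proof.
move=> mF mZ PF PZ G.
pose L K := \bigcap_(k in [set k | (K <= k)%N]) F k.
have mL K : measurable (L K) by apply: bigcap_measurableType.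
have mUL : measurable (\bigcup_K L K) by exact: bigcupT_measurable.
have mUZ : measurable (\bigcup_k Z k) by exact: bigcupT_measurable.
have GE : G = ~` (\bigcup_K L K `|` \bigcup_k Z k).
  apply/seteqP; split => w /=.
    move=> [io nZ] [[K _ LK]|[k _ /nZ//]].
    by have [k Kk] := io K; apply; exact: LK.
  move=> nU; split => [K|k Zk]; last by apply: nU; right; exists k.
  apply: contrapT => nk; apply: nU; left; exists K => // k Kk.
  by apply: contrapT => nF; apply: nk; exists k.
have PL : P (\bigcup_K L K) <= (1 / 2)%:E.
  have cv : P \o L @ \oo --> P (\bigcup_K L K).
    apply: nondecreasing_cvg_mu => // i j ij; apply/subsetPset.
    by move=> w Lw k jk; apply: Lw; exact: leq_trans jk.
  rewrite -(cvg_lim _ cv)//; apply: lime_le; first by apply/cvg_ex; exists (P (\bigcup_K L K)).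
  near=> K; apply: le_trans (PF K); apply: le_measure; rewrite ?inE//.
  by move=> w Lw; exact: (Lw K (leqnn K)).
have PUZ : P (\bigcup_k Z k) <= 0.
  apply: le_trans (measure_sigma_subadditive _ mZ mUZ (@subset_refl _ _)) _.
  by rewrite eseries0// => k _ _; apply/eqP; rewrite eq_le PZ measure_ge0.
have mU : measurable (\bigcup_K L K `|` \bigcup_k Z k) by exact: measurableU.
split; first by rewrite GE; exact: measurableC.
rewrite GE probability_setC// sube_gt0.
apply: le_lt_trans (measureU2 _ mUL mUZ) _.
apply: (@le_lt_trans _ _ ((1 / 2)%:E + 0)); first exact: leeD.
by rewrite adde0 lte_fin; lra.
Unshelve. all: by end_near. Qed.

Lemma prob_bigsetU_le (I : finType) (Q : pred I) (F : I -> set W) (r : R) :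
  (forall i, Q i -> measurable (F i)) -> (forall i, Q i -> P (F i) <= r%:E) -> (0 <= r)%R ->
  P (\big[setU/set0]_(i | Q i) F i) <= (#|I|%:R * r)%:E.
Proof.
move=> mF PF r0; rewrite cardE enumT /index_enum.
elim: (Finite.enum I) => [|i s IH]; first by rewrite big_nil measure0 mul0r.
rewrite big_cons /= -natr1 mulrDl mul1r; case: ifPn => Qi; last first.
  by rewrite (le_trans IH)// lee_fin lerDl.
apply: le_trans (measureU2 _ (mF _ Qi) _) _; first by exact: bigsetU_measurable.
by rewrite addeC EFinD leeD// PF.
Qed.

End probability_bounds.

(** At a largest entry [v i0] of a left kernel vector, column [i0] of the second block gives
    [(m + 1) |v i0| <= m |v i0|]; this column exists since [m <= p]. *)
Lemma rank_row_mx_diag_dominant (R : realFieldType) (m q p : nat) (A : 'M[R]_(m, q))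
    (X : 'M[R]_(m, p)) : (m <= p)%N -> (forall i j, 0 <= X i j <= 1) ->
  \rank (row_mx A (\matrix_(i, j) (m.+1 * (i == j :> nat))%:R + X)) = m.
Proof.
move=> mp X01; apply/eqP; apply: inj_row_free => v.
rewrite mul_mx_row -[0](@row_mx0 _ 1 q p) => /eq_row_mx[_ vB].
case: m mp A X X01 v vB => [|m] mp A X X01 v vB; first by apply/matrixP => i [].
case: (@arg_maxP _ _ _ 0 predT (fun i => `|v 0 i|) isT) => i0 _ imax.
pose j0 := widen_ord mp i0.
have E : m.+2%:R * v 0 i0 = - \sum_i v 0 i * X i j0.
  apply/eqP; rewrite -addr_eq0; have /rowP/(_ j0) := vB; rewrite !mxE => H.
  apply/eqP; rewrite -[RHS]H.
  under [RHS]eq_bigr do rewrite !mxE mulrDr.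
  rewrite big_split/=; congr (_ + _).
  rewrite (bigD1 i0)//= eqxx muln1 big1 ?addr0 1?mulrC// => i ii0.
  by rewrite (_ : (i == i0 :> nat) = false) ?muln0 ?mulr0//; apply/negbTE.
have : m.+2%:R * `|v 0 i0| <= m.+1%:R * `|v 0 i0|.
  rewrite -[m.+2%:R]ger0_norm// -normrM E normrN (le_trans (ler_norm_sum _ _ _))//.
  apply: (@le_trans _ _ (\sum_(i < m.+1) `|v 0 i0|)).
    apply: ler_sum => i _; rewrite normrM; have /andP[x0 x1] := X01 i j0.
    by rewrite (ger0_norm x0) -[leRHS]mulr1 ler_pM//; exact: imax.
  by rewrite sumr_const card_ord mulr_natl.
rewrite -[m.+2%:R]natr1 mulrDl mul1r gerDl normr_le0 => /eqP v0.
apply/rowP => i; rewrite mxE; apply/eqP; rewrite -normr_le0.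
by apply: le_trans (imax i isT) _; rewrite v0 normr0.
Qed.

Lemma lin_indep_rat_int (R : realType) (I : finType) (v : I -> R) :
  (forall q : I -> int, \sum_i (q i)%:~R * v i = 0 -> forall i, q i = 0) ->
  lin_indep_rat v.
Proof.
move=> indep a rel i.
pose D := \prod_i denq (a i).
have D0 : D != 0 by apply/prodf_neq0 => j _; exact: denq_neq0.
have qD j : exists q : int, D%:~R * a j = q%:~R :> rat.
  pose r := \prod_(l | l != j) denq (a l); exists (numq (a j) * r).
  have -> : D = denq (a j) * r by rewrite /D (bigD1 j).
  rewrite !intrM mulrC mulrA -{1}[a j]divq_num_den divfK// intr_eq0.
  exact: denq_neq0.
have [q qE] := choice qD.
have qR j : (q j)%:~R = D%:~R * ratr (a j) :> R.
  by have := congr1 (ratr : rat -> R) (qE j); rewrite rmorphM/= !ratr_int => ->.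
have q0 : q i = 0.
  apply: indep; under eq_bigr do rewrite qR -mulrA.
  by rewrite -mulr_sumr rel mulr0.
by have := qE i; rewrite q0 => /eqP; rewrite mulf_eq0 intr_eq0 (negbTE D0) => /eqP.
Qed.

Lemma big_option (R : nmodType) (T : finType) (F : option T -> R) :
  \sum_k F k = F None + \sum_t F (Some t).
Proof.
rewrite (bigD1 None)//= (reindex_omap Some id) /=; last by case.
by congr (_ + _); apply: eq_bigl => t; rewrite /= eqxx.
Qed.

Lemma sum_entries1 (R : realType) (m p : nat) (A : 'M[R]_(m, 2)) (B : 'M[R]_(m, p))
    (q : option ('I_m * 'I_(2 + p)) -> int) :
  \sum_k (q k)%:~R * entries1 (row_mx A B) k =
  \sum_i \sum_j (q (Some (i, rshift 2 j)))%:~R * B i j +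
  (\sum_i \sum_j (q (Some (i, lshift p j)))%:~R * A i j + (q None)%:~R).
Proof.
rewrite big_option mulr1 [LHS]addrC addrA; congr (_ + _).
rewrite -big_split/= (eq_bigr (fun t : 'I_m * 'I_(2 + p) =>
  (q (Some (t.1, t.2)))%:~R * row_mx A B t.1 t.2)); last by case.
rewrite -(pair_bigA _ (fun i j => (q (Some (i, j)))%:~R * row_mx A B i j)) /=.
apply: eq_bigr => i _; rewrite big_split_ord/= addrC; congr (_ + _).
  by apply: eq_bigr => j _; rewrite row_mxEr.
by apply: eq_bigr => j _; rewrite row_mxEl.
Qed.

(** Stated for every [S] containing the restricted set, so that it yields both claims of the
    theorem. *)
Lemma hausdorff_dim_FS_ge (R : realType) (m p : nat)
    (N1 : 'cV[R]_(2 + p) -> R) (N2 : 'cV[R]_m -> R) :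
  (0 < m)%N -> (m <= p)%N -> 2 <= (2 + p)%:R / m%:R :> R ->
  is_norm N1 -> is_norm N2 ->
  exists2 cmn : R, 0 < cmn & forall c, 0 <= c <= cmn -> forall S : set 'M[R]_(m, 2 + p),
    FS N1 N2 c `&` [set Om | \rank Om = m /\ lin_indep_rat (entries1 Om)] `<=` S ->
    ((m * p)%:R%:E <= hausdorff_dim S)%E.
Proof.
move=> m0 mp a2 nN1 nN2; set a : R := _ / _ in a2.
pose N (v : 'cV[R]_2) := N1 (col_mx v 0).
have nN : is_norm N.
  have [N10 N1Z N1D] := nN1; split => [v|b v|u v]; rewrite /N.
  - by move=> /N10/(congr1 usubmx); rewrite col_mxKu linear0.
  - by rewrite -N1Z scale_col_mx scaler0.
  - by rewrite (le_trans _ (N1D _ _))// add_col_mx addr0.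
have [c0 c00 columns] := exists_columns m0 nN nN2 a2.
have [k1 k10 k1N] := is_norm_ge nN1; have [k2 k20 k2N] := is_norm_ge nN2.
(* Constant of the union bound: at most [(T (2/k1 + 3))^(2+p)] vectors, each with probability at
   most [(10 eps / k2)^m]. *)
pose C : R := (2 / k1 + 3) ^+ (2 + p) * (10 / k2) ^+ m.
have C0 : 0 < C by rewrite mulr_gt0// exprn_gt0 ?divr_gt0// addr_gt0// divr_gt0.
(* The entry 1 gives [cmn ^+ m <= cmn], and the last one makes the union bound at most 1/2. *)
pose cmn := Num.min c0 (Num.min 1 (1 / (2 * C))).
have cmn0 : 0 < cmn by rewrite !lt_min c00 ltr01 divr_gt0// mulr_gt0.
have cmn1 : cmn <= 1 by rewrite !ge_min lexx orbT.
have cmnc0 : cmn <= c0 by rewrite !ge_min lexx.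
have cmnC : C * cmn <= 1 / 2.
  have : cmn <= 1 / (2 * C) by rewrite !ge_min lexx !orbT.
  rewrite ler_pdivlMr; last exact: mulr_gt0.
  by move: (cmn) (C) => u v; lra.
exists cmn => // c /andP[cge0 ccmn] S FS_S.
(* For c = 0 positive target values tending to 0 are needed. *)
pose ck k := Num.max c (cmn / k.+1%:R).
have ckcmn k : 0 < ck k <= cmn.
  rewrite lt_max ge_max ccmn divr_gt0 ?ltr0Sn// orbT /=.
  by rewrite ler_pdivrMr ?ltr0Sn// ler_peMr ?(ltW cmn0)// ler1n.
have ck_bounds k : [/\ 0 < ck k, c <= ck k, ck k <= 1 & ck k <= c + k.+1%:R^-1].
  have /andP[ck0 ckc] := ckcmn k; split => //; first by rewrite le_max lexx.
    exact: le_trans cmn1.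
  rewrite ge_max lerDl invr_ge0 ler0n /= (@le_trans _ _ k.+1%:R^-1)//; last by rewrite lerDr.
  by rewrite ler_piMl// invr_ge0.
have [|A [x [eps [eps_bounds eps_ub eps_lb A_indep]]]] := columns ck.
  by move=> k; have /andP[-> h] := ckcmn k; exact: le_trans cmnc0.
have [d [W [P [X [mX X01 boxX nearX nullX]]]]] := exists_unif_matrix R m p.
(* The shift E makes E + X w diagonally dominant, hence of full rank. *)
pose E : 'M[R]_(m, p) := \matrix_(i, j) (m.+1 * (i == j :> nat))%:R.
pose Om w : 'M[R]_(m, 2 + p) := row_mx A (E + X w).
pose T k := N (iv (x k.+1)).
have T1 k : 1 <= T k.
  have [_ h _ _] := eps_bounds k; apply: le_trans h; rewrite -[leLHS]mulr1 ler_pM// ?ler1n//.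
  by rewrite lerDl is_norm_ge0.
pose K k := (Num.truncn (T k / k1)).+1.
pose b k (f : 'cV['I_(K k + K k).+1]_(2 + p)) : 'cV[int]_(2 + p) := box_dec f.
pose sh (b' : 'cV[int]_(2 + p)) i : R := (A *m iv (usubmx b') + E *m iv (dsubmx b')) i 0.
(* Every entry of [Om w b'] is close to an integer; this follows whenever some integer shift of
   [Om w b'] has norm at most [eps k]. *)
pose Ev k (b' : 'cV[int]_(2 + p)) := [set w | forall i,
  near_int (eps k / k2) (\sum_j (dsubmx b' j 0)%:~R * X w i j + sh b' i)].
pose F k := \big[setU/set0]_(f | dsubmx (b k f) != 0) Ev k (b k f).
have mlin (q : 'I_m -> 'I_p -> R) s :
    measurable_fun setT (fun w => \sum_i \sum_j q i j * X w i j + s).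
  apply: measurable_funD => //; apply: measurable_sum => i; apply: measurable_sum => j.
  exact: measurable_funM.
have mEv k b' : measurable (Ev k b').
  rewrite /Ev (_ : mkset _ = \big[setI/setT]_i ((fun w => \sum_j (dsubmx b' j 0)%:~R * X w i j + sh b' i)
      @^-1` near_int (eps k / k2))).
    apply: bigsetI_measurable => i _; rewrite -[X in measurable X]setTI.
    have mf : measurable_fun setT (fun w => \sum_j (dsubmx b' j 0)%:~R * X w i j + sh b' i).
      by apply: measurable_funD => //; apply: measurable_sum => j; exact: measurable_funM.
    by apply: mf => //; exact: measurable_near_int.
  by rewrite -bigcap_seq; apply/seteqP; split => w /= H i => [_|]; apply: H; rewrite /= ?mem_index_enum.
have mF k : measurable (F k) by exact: bigsetU_measurable.
have PF k : (P (F k) <= (1 / 2)%:E)%E.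
  have [eps0 _ ub _] := eps_bounds k; have /andP[ck0 ckc] := ckcmn k.
  have e0 : 0 <= eps k / k2 by rewrite divr_ge0// ltW.
  apply: le_trans (prob_bigsetU_le (r := (10 * (eps k / k2)) ^+ m) _ _ _) _ => //.
  - move=> f f0; apply: nearX => //.
    apply: contrapT => nf; move/eqP: f0; apply; apply/colP => j; rewrite [RHS]mxE.
    by apply: contrapT => fj; apply: nf; exists j; apply/eqP.
  - by rewrite exprn_ge0// mulr_ge0.
  rewrite lee_fin card_mx card_ord muln1 natrX.
  have Kle : (K k + K k).+1%:R <= T k * (2 / k1 + 3).
    have h1 : (Num.truncn (T k / k1))%:R <= T k / k1.
      by rewrite truncn_le// divr_ge0 ?is_norm_ge0// ltW.
    rewrite -natr1 natrD /K -natr1 mulrDr.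
    have -> : T k * (2 / k1) = 2 * (T k / k1) by ring.
    by have := T1 k; move: h1; move: (T k / k1) (T k) => y y'; lra.
  (* As [a = (2 + p) / m], the left side is the [m]-th power of [eps k] times [T k] to the power
     [a]. *)
  have eT : T k ^+ (2 + p) * eps k ^+ m <= ck k ^+ m.
    have -> : T k ^+ (2 + p) = (T k `^ a) ^+ m.
      rewrite -powR_mulrn ?(le_trans ler01)// -powR_mulrn ?powR_ge0// -powRrM /a.
      by rewrite divfK// pnatr_eq0 -lt0n.
    rewrite -exprMn mulrC; apply: lerXn2r; rewrite ?nnegrE ?mulr_ge0 ?powR_ge0// ?ltW//.
  apply: (@le_trans _ _ ((T k * (2 / k1 + 3)) ^+ (2 + p) * (10 * (eps k / k2)) ^+ m)).
    apply: ler_wpM2r; first by rewrite exprn_ge0// mulr_ge0.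
    apply: lerXn2r => //; rewrite nnegrE// mulr_ge0 ?(le_trans ler01 (T1 k))//.
    by rewrite addr_ge0// divr_ge0// ltW.
  have -> : (T k * (2 / k1 + 3)) ^+ (2 + p) * (10 * (eps k / k2)) ^+ m =
      C * (T k ^+ (2 + p) * eps k ^+ m).
    by rewrite /C -[10 * _]mulrCA [eps k * _]mulrC !exprMn; ring.
  apply: (le_trans _ cmnC); rewrite ler_pM2l// (le_trans eT)//.
  apply: (@le_trans _ _ (cmn ^+ m)); first by rewrite lerXn2r// nnegrE ltW.
  by rewrite ler_iXnr// ltW.
(* Integer relations are encoded as finite functions, a countable type enumerated by [unpickle].
   Each one that involves the random block holds with probability 0. *)
pose Q := {ffun option ('I_m * 'I_(2 + p)) -> int}.
pose Bpart (q : Q) i j := q (Some (i, rshift 2 j)).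
pose sq (q : Q) : R := \sum_i \sum_j (Bpart q i j)%:~R * E i j +
  (\sum_i \sum_j (q (Some (i, lshift p j)))%:~R * A i j + (q None)%:~R).
pose Z n := if unpickle n is Some q then
    if [exists i, exists j, Bpart q i j != 0]
    then [set w | \sum_i \sum_j (Bpart q i j)%:~R * X w i j + sq q = 0] else set0
  else set0.
have mZ n : measurable (Z n).
  rewrite /Z; case: (unpickle n) => [q|//]; case: ifP => // _.
  have := mlin (fun i j => (Bpart q i j)%:~R) (sq q).
  by move=> /(_ measurableT _ (measurable_set1 0)); rewrite setTI.
have PZ n : (P (Z n) <= 0)%E.
  rewrite /Z; case: (unpickle n) => [q|]; last by rewrite measure0.
  case: ifP => [/existsP[i /existsP[j qij]]|_]; last by rewrite measure0.
  by apply: (nullX (fun i j => (Bpart q i j)%:~R)); exists i, j; rewrite intr_eq0.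
have [mG PG] := prob_infinitely_often mF mZ PF PZ.
set G := [set w | _] in mG PG.
apply: (hausdorff_dim_ge (g := Om) mX boxX _ mG PG).
- by rewrite muln_gt0 m0 (leq_trans m0).
- move=> w [io nZ]; apply: FS_S.
  have goodB K0 : exists2 k, (K0 <= k)%N & forall v z y, z != 0 ->
      N1 (iv (col_mx v z)) <= N (iv (x k.+1)) ->
      eps k <= N2 (A *m iv v + (E + X w) *m iv z + iv y).
    have [k Kk nF] := io K0; exists k => // v z y z0 vzT.
    rewrite leNgt; apply/negP => small; apply: nF.
    have [f fE] : exists f, col_mx v z = b k f.
      apply: (@box_decP R); rewrite (@le_trans _ _ (T k / k1))//.
        by rewrite ler_pdivlMr// mulrC (le_trans (k1N _)).
      by apply: ltW; exact: truncnS_gt.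
    rewrite /F (bigD1 f) -fE ?col_mxKd//=; left => i; exists (y i 0).
    rewrite ler_pdivlMr// mulrC; apply/ltW/(le_lt_trans _ small).
    set u := (X in N2 X); have -> : \sum_j (dsubmx (col_mx v z) j 0)%:~R * X w i j +
        sh (col_mx v z) i + (y i 0)%:~R = u i 0.
      rewrite /sh col_mxKd col_mxKu /u mulmxDl !mxE addrCA !addrA; congr (_ + _).
      rewrite addrAC -!addrA addrC -!addrA; congr (_ + (_ + _)).
      by apply: eq_bigr => j _; rewrite mxE mulrC.
    by apply: le_trans (k2N u); rewrite ler_pM2l// cV_entry_le.
  split.
    split.
      apply/eqP; rewrite eq_le; apply/andP; split.
        exact: (Theta_le nN1 a2 _ ck_bounds eps_bounds eps_ub).
      exact: (Theta_ge nN1 a2 ck_bounds eps_bounds eps_lb goodB).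
    apply/negP; rewrite -leNgt.
    exact: (Theta_inf_le0 nN1 a2 _ ck_bounds eps_bounds eps_ub).
  split; first exact: rank_row_mx_diag_dominant.
  apply: lin_indep_rat_int => q rel.
  pose q' : Q := [ffun k => q k].
  (* Coefficients on the random block vanish because [w] avoids every [Z n]; those on [A] then
     vanish by the construction of [A]. *)
  have B0 i j : q (Some (i, rshift 2 j)) = 0.
    apply: contrapT => /eqP qij; apply: (nZ (pickle q')).
    rewrite /Z pickleK; case: ifPn => [_|]; last first.
      by move=> /existsPn/(_ i)/existsPn/(_ j); rewrite /Bpart ffunE qij.
    rewrite /= -[RHS]rel sum_entries1 /sq /Bpart [LHS]addrA.
    congr (_ + _); last by rewrite !ffunE; congr (_ + _); apply: eq_bigr => i' _; apply: eq_bigr => j' _; rewrite ffunE.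
    rewrite -big_split; apply: eq_bigr => i' _; rewrite -big_split; apply: eq_bigr => j' _.
    by rewrite /= !ffunE [(E + X w) _ _]mxE mulrDr addrC.
  have A0 : \sum_i \sum_j (q (Some (i, lshift p j)))%:~R * A i j + (q None)%:~R = 0.
    rewrite -[RHS]rel sum_entries1 [X in _ = X + _]big1 ?add0r// => i _.
    by rewrite big1// => j _; rewrite B0 mul0r.
  have A1 := A_indep _ _ A0.
  have q0 : q None = 0.
    move: A0; rewrite big1 ?add0r => [/eqP|i _].
      by rewrite intr_eq0 => /eqP.
    by rewrite big1// => j _; rewrite A1 mul0r.
  move=> [[i j]|//]; case: (split_ordP j) => j' ->; [exact: A1|exact: B0].
- move=> w w' i j.
  have -> : X w i j - X w' i j = (Om w - Om w') i (rshift 2 j).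
    by rewrite /Om opp_row_mx add_row_mx row_mxEr !mxE; ring.
  rewrite [leRHS]/Num.norm/= mx_normrE; apply/bigmax_geP; right.
  by exists (i, rshift 2 j).
Qed.

Lemma hausdorff_dim_ge0 (R : realType) (V : normedModType R) (S : set V) :
  (0 <= hausdorff_dim S)%E.
Proof. by apply: le_ereal_inf_tmp => _ [s [s0 _] <-]; rewrite lee_fin. Qed.

Theorem theorem3p6 (R : realType) (m n : nat)
    (m_gt0 : (0 < m)%N) (n_gt0 : (0 < n)%N)
    (mn_half : m%:R / n%:R <= 1 / 2 :> R) (mn_neq : (m, n) <> (1%N, 3%N))
    (N1 : 'cV[R]_n -> R) (N2 : 'cV[R]_m -> R)
    (N1_norm : is_norm N1) (N2_norm : is_norm N2) :
  exists2 cmn : R, 0 < cmn &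
    forall c : R, 0 <= c <= cmn ->
      (((n%:R - 2) * m%:R)%:E <= hausdorff_dim (FS N1 N2 c))%E /\
      (((n%:R - 2) * m%:R)%:E <= hausdorff_dim
         (FS N1 N2 c `&`
          [set Om | \rank Om = m /\ lin_indep_rat (entries1 Om)]))%E.
Proof.
have mn : (2 * m <= n)%N.
  move: mn_half; rewrite ler_pdivrMr ?ltr0n// mul1r ler_pdivlMl//.
  by rewrite -natrM ler_nat.
case: n n_gt0 mn_half mn_neq N1 N1_norm mn => [//|[|p]] _ mn_half mn_neq N1 N1_norm mn.
  by move: m_gt0 mn; clear; lia.
have -> : (p.+2%:R - 2) * m%:R = (m * p)%:R :> R.
  by rewrite -addn2 natrD addrK natrM mulrC.
(* For [n = 2] the claimed bound is 0 and any positive constant serves. *)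
have [p0|p_gt0] := posnP p.
  have -> : (m * p)%:R = 0 :> R by rewrite p0 muln0.
  by exists 1 => // c _; split; exact: hausdorff_dim_ge0.
(* From [p >= 1] and [2 m <= p + 2] follows [m <= p], as the rank argument requires. *)
have mp : (m <= p)%N by move: p_gt0 mn; clear; lia.
have a2 : 2 <= (2 + p)%:R / m%:R :> R by rewrite ler_pdivlMr ?ltr0n// -natrM ler_nat.
have [cmn cmn0 H] := @hausdorff_dim_FS_ge R m p N1 N2 m_gt0 mp a2 N1_norm N2_norm.
by exists cmn => // c hc; split; apply: (H c hc) => // Om [].
Qed.
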